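(* Let $m\ge 2$ be an even integer, let $k\ge 0$ and $n\ge k+m$ be integers. For every $\mathcal{Z}\in\mathrm{Mat}_{n,k+m}^{>0}$ and every $Y\in\mathcal{A}_{n,k,m}^{\mathrm{wcb}}$ (the part of the amplituhedron of $\mathcal{Z}$ lying off its coarse boundary locus), the winding number $w_{n,k,m}(Y,\mathcal{Z})$ is independent of $Y$ and of $\mathcal{Z}$, and it equals $$w_{n,k,m}(Y,\mathcal{Z})=\binom{\left\lfloor \frac{k+m-1}{2}\right\rfloor}{\frac m2}.$$
   Context: Notation. $[n]=\{1,\dots,n\}$; for a set $X$ of integers $\binom{X}{p}$ is the set of strictly increasing lists of $p$ elements of $X$. $\mathrm{Gr}_{k,n}$ is the real Grassmannian of $k$-planes in $\mathbb{R}^n$, a point being represented by a $k\times n$ matrix of rank $k$ whose rows span it; $\mathrm{Gr}_{k,n}^{\ge0}$ (resp. $\mathrm{Gr}_{k,n}^{>0}$) is the set of points having a representative all of whose maximal minors are $\ge 0$ (resp. $>0$). $\mathrm{Mat}_{n,k+m}^{>0}$ is the set of real $n\times(k+m)$ matrices all of whose maximal minors (rows taken in increasing order) are positive; the rows of $\mathcal{Z}$ are $\mathcal{Z}_1,\dots,\mathcal{Z}_n\in\mathbb{R}^{k+m}$. Amplituhedron. For $k+m\le n$ and $\mathcal{Z}\in\mathrm{Mat}_{n,k+m}^{>0}$, $\mathcal{A}_{n,k,m}\subset\mathrm{Gr}_{k,k+m}$ is the image of $\mathrm{Gr}_{k,n}^{\ge0}$ under the map sending the point represented by $C$ to the point represented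 by $C\mathcal{Z}$. Twistor coordinates. For $Y\in\mathrm{Gr}_{k,k+m}$ with a representative matrix with rows $Y_1,\dots,Y_k$, $\langle Y,i_1,\dots,i_m\rangle:=\det(Y_1,\dots,Y_k,\mathcal{Z}_{i_1},\dots,\mathcal{Z}_{i_m})$. They are defined up to a common nonzero factor; for $Y\in\mathcal{A}_{n,k,m}$ one uses the representative $C\mathcal{Z}$ with $C$ having nonnegative maximal minors. Coarse boundary ($m$ even). The coarse boundary conditions are: $\langle Y,I\rangle\ge0$ for all $I=(i_1,i_1+1,\dots,i_{m/2},i_{m/2}+1)\in\binom{[n]}{m}$, and $(-1)^{k+1}\langle Y,I,n,1\rangle\ge 0$ for all $I=(i_1,i_1+1,\dots,i_{m/2-1},i_{m/2-1}+1)\in\binom{\{2,\dots,n-1\}}{m-2}$. They hold on $\mathcal{A}_{n,k,m}$. Let $\mathcal{L}\subset\mathrm{Gr}_{k,k+m}$ be the locus where at least one of these twistor coordinates is zero. Put $\mathcal{A}_{n,k,m}^{\mathrm{wcb}}=\mathcal{A}_{n,k,m}\setminus\mathcal{L}$ and $\mathrm{Gr}_{k,k+m}^{\mathrm{wcb}}=\mathrm{Gr}_{k,k+m}\setminus\mathcal{L}$. Winding number. For $Y\in\mathrm{Gr}_{k,k+m}$ let $V_Y=\mathbb{R}^{k+m}/Y\simeq\mathbb{R}^m$, $\pi_Y:\mathbb{R}^{k+m}\to V_Y$ the quotient map, $Z_i=\pi_Y(\mathcal{Z}_i)$. Orient $V_Y$ so that $(\pi_Y(f_1),\dots,\pi_Y(f_m))$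 is a positive basis iff $\det(Y_1,\dots,Y_k,f_1,\dots,f_m)>0$. For a list $I=(a_1,\dots,a_m)$ let $S(I)$ be the convex hull of $Z_{a_1},\dots,Z_{a_m}$ in $V_Y$, regarded also as the singular affine $(m-1)$-simplex sending the ordered vertices of the standard simplex to $Z_{a_1},\dots,Z_{a_m}$. Let $P(Y,\mathcal{Z})$ be the union (and, as a singular chain, the sum) of all $S(I)$ with $I=(i_1,i_1+1,\dots,i_{m/2},i_{m/2}+1)\in\binom{[n]}{m}$ and all $S(J,n,1)$ with $J=(j_1,j_1+1,\dots,j_{m/2-1},j_{m/2-1}+1)\in\binom{\{2,\dots,n-1\}}{m-2}$. This chain is a cycle. If $Y\in\mathrm{Gr}_{k,k+m}^{\mathrm{wcb}}$, the origin of $V_Y$ is not in $P(Y,\mathcal{Z})$, and $w_{n,k,m}(Y,\mathcal{Z})\in\mathbb{Z}$ is the degree of $f:P(Y,\mathcal{Z})\to S^{m-1}$, $f(x)=x/\|x\|$, i.e. the image of the class of the cycle under $f_*:H_{m-1}(P(Y,\mathcal{Z}))\to H_{m-1}(S^{m-1})\simeq\mathbb{Z}$, where $S^{m-1}\subset V_Y$ is the unit sphere with its outward-normal-first orientation (so a simplex $S(I)$ with $\langle Y,I\rangle>0$ hit by a generic ray from the origin contributes $+1$, and one with $\langle Y,I\rangle<0$ contributes $-1$).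
   Formalization: For m ≥ 4 the sum of the ordered singular simplices S(I) and S(J,n,1) is not a cycle, so its class is undefined (e.g. k=0, m=n=4); the formal chain uses −S(1,J,n), the same oriented simplex, in place of S(J,n,1). *)

(* Defs.v *)
From HB Require Import structures.
From mathcomp Require Import all_boot all_order all_algebra.
From mathcomp Require Import all_classical all_reals all_analysis.
From mathcomp.multinomials Require Import freeg.
Set Implicit Arguments.
Unset Strict Implicit.
Unset Printing Implicit Defensive.
Import Order.TTheory GRing.Theory Num.Theory.
Import numFieldNormedType.Exports.
Local Open Scope classical_set_scope.
Local Open Scope ring_scope.

Section Singular.
Variable R : realType.
Implicit Types (d p : nat).

Definition std_simplex p : set 'rV[R]_p.+1 :=
  [set t | (forall i, 0 <= t 0 i) /\ \sum_i t 0 i = 1].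

(* A singular p-simplex of R^d is encoded as a total function on R^(p+1) that
   is 0 off the standard simplex, so that two simplices are equal as functions
   iff they agree on the standard simplex. *)
Notation simplex p d := ('rV[R]_p.+1 -> 'rV[R]_d).

Definition clip p d (s : simplex p d) : simplex p d :=
  patch (fun=> 0) (@std_simplex p) s.

Definition singular_simplex p d (A : set 'rV[R]_d) (s : simplex p d) : Prop :=
  [/\ clip s = s, {within @std_simplex p, continuous s}
    & s @` @std_simplex p `<=` A].

Definition affine_simplex p d (v : nat -> 'rV[R]_d) : simplex p d :=
  clip (fun t => \sum_(i < p.+1) t 0 i *: v i).

Definition face_map p (i : 'I_p.+2) (t : 'rV[R]_p.+1) : 'rV[R]_p.+2 :=
  \row_j (if unlift i j is Some j' then t 0 j' else 0).

Definition boundary p d (c : {freeg (simplex p.+1 d)}) : {freeg (simplex p d)} :=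
  fglift (fun s : simplex p.+1 d =>
    \sum_(i < p.+2) (-1) ^+ i *: << clip (s \o face_map i) >>) c.

Definition push p d (f : 'rV[R]_d -> 'rV[R]_d) (c : {freeg (simplex p d)}) :
    {freeg (simplex p d)} :=
  fglift (fun s : simplex p d => << clip (f \o s) >>) c.

(* For p-cycles [c] and [c'] of [A]: equality of classes in H_p(A; Z). *)
Definition homologous p d (A : set 'rV[R]_d) (c c' : {freeg (simplex p d)}) :
    Prop :=
  exists2 b : {freeg (simplex p.+1 d)},
    {in dom b, forall s, singular_simplex A s} & c - c' = boundary b.

Definition enorm d (x : 'rV[R]_d) : R := Num.sqrt (\sum_i x 0 i ^+ 2).

Definition sphere d : set 'rV[R]_d := [set x | enorm x = 1].

Definition radial d (x : 'rV[R]_d) : 'rV[R]_d := (enorm x)^-1 *: x.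

(* [corner 0] = (-1,...,-1) and [corner i] = e_i for 1 <= i <= d: the vertices
   of a simplex that contains 0 in its interior and is positively oriented,
   i.e. det(v_1 - v_0, ..., v_d - v_0) > 0. *)
Definition corner d (i : nat) : 'rV[R]_d :=
  \row_j (if i is i'.+1 then (j == i' :> nat)%:R else -1).

(* The generator of H_(d-1)(S^(d-1)) given by the outward-normal-first
   orientation, for d >= 2: the radial projection of the boundary of a
   positively oriented d-simplex around 0. *)
Definition sphere_class d : {freeg (simplex d.-1 d)} :=
  push (@radial d) (boundary << @affine_simplex d.-1.+1 d (@corner d) >>).

End Singular.

Section Amplituhedron.
Variable R : realType.
Implicit Types (n k m : nat).

Definition increasing p n (f : 'I_p -> 'I_n) : Prop :=
  {homo f : i j / (i < j)%N}.

Definition positive_rows n p (Z : 'M[R]_(n, p)) : Prop :=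
  forall f : 'I_p -> 'I_n, increasing f -> 0 < \det (rowsub f Z).

Definition nonneg_cols k n (C : 'M[R]_(k, n)) : Prop :=
  forall f : 'I_k -> 'I_n, increasing f -> 0 <= \det (colsub f C).

(* [Y] is a representative, of the form used for twistor coordinates, of a
   point of the amplituhedron of [Z]. *)
Definition amplituhedron n k m (Z : 'M[R]_(n, k + m)) (Y : 'M[R]_(k, k + m)) :
    Prop :=
  exists C : 'M[R]_(k, n), [/\ \rank C = k, nonneg_cols C & Y = C *m Z].

(* The i-th row of Z, where 1 <= i <= n. *)
Definition zrow n p (Z : 'M[R]_(n, p)) (i : nat) : 'rV[R]_p :=
  if insub i.-1 is Some a then row a Z else 0.

Definition twistor n k m (Z : 'M[R]_(n, k + m)) (Y : 'M[R]_(k, k + m))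
    (I : seq nat) : R :=
  \det (col_mx Y (\matrix_(a < m) zrow Z (nth 0%N I a))).

Definition pairs (j : seq nat) : seq nat := flatten [seq [:: i; i.+1] | i <- j].

(* The lists (i_1, i_1 + 1, ..., i_p, i_p + 1) that are strictly increasing
   with entries in {a, ..., b}. *)
Definition pair_lists (p a b : nat) : seq (seq nat) :=
  [seq I <- [seq pairs [seq val i | i <- tval j] | j : p.-tuple 'I_b.+1]
     | sorted ltn I & all (fun i => a <= i <= b)%N I].

Definition off_coarse_boundary n k m (Z : 'M[R]_(n, k + m))
    (Y : 'M[R]_(k, k + m)) : Prop :=
  {in pair_lists m./2 1 n, forall I, twistor Z Y I != 0} /\
  {in pair_lists m./2.-1 2 n.-1, forall J, twistor Z Y (J ++ [:: n; 1%N]) != 0}.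

(* [Q] is the matrix of the quotient map R^(k+m) -> V_Y (acting on row vectors
   on the right) in some positive basis of V_Y, i.e. [Q] identifies the
   oriented space V_Y with R^m. *)
Definition oriented_quotient k m (Y : 'M[R]_(k, k + m)) (Q : 'M[R]_(k + m, m)) :
    Prop :=
  [/\ row_full Q, (kermx Q == Y)%MS
    & forall F : 'M[R]_(m, k + m),
        (0 < \det (F *m Q)) = (0 < \det (col_mx Y F))].

(* The simplex S(a_1, ..., a_m) in the coordinates given by [Q]. *)
Definition zsimplex n k m (Z : 'M[R]_(n, k + m)) (Q : 'M[R]_(k + m, m))
    (I : seq nat) : 'rV[R]_m.-1.+1 -> 'rV[R]_m :=
  @affine_simplex R m.-1 m (fun a => zrow Z (nth 0%N I a) *m Q).

(* The cycle P(Y, Z).  Its summand S(J, n, 1) is to be read as an oriented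
   simplex, and is represented here by - S(1, J, n): moving 1 to the front of
   (J, n, 1) passes m - 1 entries, an odd number since m is even.  With the
   ordered simplices S(J, n, 1) themselves the faces cancel only up to
   reordering of vertices, and the singular chain is not a cycle for m >= 4. *)
Definition winding_cycle n k m (Z : 'M[R]_(n, k + m)) (Q : 'M[R]_(k + m, m)) :
    {freeg ('rV[R]_m.-1.+1 -> 'rV[R]_m)} :=
  \sum_(I <- pair_lists m./2 1 n) << zsimplex Z Q I >>
  - \sum_(J <- pair_lists m./2.-1 2 n.-1) << zsimplex Z Q (1%N :: rcons J n) >>.

(* w(Y, Z) = w, that is f_*[P(Y, Z)] = w [S^(m-1)] in H_(m-1)(S^(m-1)) = Z.
   The unit sphere of V_Y is taken for the Euclidean norm of the coordinates
   [Q], all choices of which are considered. *)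
Definition has_winding_number n k m (Z : 'M[R]_(n, k + m))
    (Y : 'M[R]_(k, k + m)) (w : int) : Prop :=
  forall Q : 'M[R]_(k + m, m), oriented_quotient Y Q ->
    homologous (@sphere R m) (push (@radial R m) (winding_cycle Z Q))
      (w *: sphere_class R m).

End Amplituhedron.

(* Main.v *)
(**
Let V_Y = R^m and let P be the winding cycle.  For a vector x outside the
finitely many hyperplanes spanned by all but one of the vertices of a facet of P,
coning off P from x writes P as the boundary of the signed sum of the simplices
[x, F], F a facet.  In R^m minus
the origin, the boundary of [x, F] is null-homologous unless the origin lies in
[x, F], in which case it is homologous to plus or minus the fundamental class of
the sphere, because GL_m(R)^+ is generated by elementary matrices.  Hence P is
homologous to N times the fundamental class, where N depends only on the signs
of finitely many twistor coordinates.  For a continuous family of Y off the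
coarse boundary these signs are locally constant, so the winding number can be
transported along the family.

By the Cauchy-Binet formula the coarse twistor coordinates are, up to a fixed
sign, combinations of the maximal minors of C with nonnegative coefficients.
Adding to a column of C a positive multiple of an adjacent column does not
decrease any minor, and finitely many such moves make all minors positive.
Scaling down the columns of index greater than k + m then leads to C = [B, 0],
with all minors of B positive, without meeting the coarse boundary.

For such a C, use the triangulation of the cyclic polytope by the simplices
[1, I], where I runs over the unions of m/2 pairs {i, i+1} in {2, ..., n}: P is
the sum of their boundaries.  If max I > k + m, the signs of the coarse twistor
coordinates exclude the origin from [1, I].  Otherwise all signs are explicit,
and the origin is in [1, I] iff all pairs of I start with an even number.  There
are binom(floor((k+m-1)/2), m/2) such I.
*)

Require Import Defs.
From mathcomp Require Import all_boot all_order all_algebra perm.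
From mathcomp Require Import all_classical all_reals all_analysis.
From mathcomp.multinomials Require Import freeg.
From mathcomp Require Import fintype.
From mathcomp Require Import ring lra zify.
Set Implicit Arguments.
Unset Strict Implicit.
Unset Printing Implicit Defensive.
Import Order.TTheory GRing.Theory Num.Theory.
Import numFieldNormedType.Exports.
Local Open Scope classical_set_scope.
Local Open Scope ring_scope.

(** * Alternating sums over faces *)

Section AlternatingDeletion.
Variables (T : Type) (V : zmodType).
Implicit Types (f g : seq T -> V) (l : seq T).

(* The alternating sum of [f] over the faces of [l], i.e. [f] of the
   simplicial boundary of the ordered simplex [l]. *)
Fixpoint altdel f l : V :=
  if l is a :: l' then f l' - altdel (fun s => f (a :: s)) l' else 0.

Lemma altdelB f g l : altdel (fun s => f s - g s) l = altdel f l - altdel g l.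
Proof.
elim: l f g => [|a l IH] f g /=; first by rewrite subr0.
by rewrite IH !opprB addrACA [RHS]addrACA [- _ + _]addrC.
Qed.

(** The identity ∂∂ = 0: after the first vertex is split off, [altdel f l] occurs twice with
    opposite signs, and induction on the cone over that vertex removes the rest. *)
Lemma altdelK f l : altdel (altdel f) l = 0.
Proof.
elim: l f => //= a l IH f.
by rewrite altdelB (IH (fun s => f (a :: s))) subr0 subrr.
Qed.

Lemma altdelE f l :
  altdel f l = \sum_(i < size l) f (take i l ++ drop i.+1 l) *~ (-1) ^+ i.
Proof.
elim: l f => [|a l IH] f /=; first by rewrite big_ord0.
rewrite big_ord_recl /= drop0 expr0 mulr1z IH -sumrN; congr (_ + _).
by apply: eq_bigr => i _; rewrite exprS mulN1r mulrNz.
Qed.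

End AlternatingDeletion.

(* The lists (i_1, i_1 + 1, ..., i_r, i_r + 1), strictly increasing, with entries
   in the interval [a, a + len - 1]. *)
Fixpoint paired (r len a : nat) : seq (seq nat) :=
  if r is r'.+1 then
    if len is len'.+1 then
      (if len' is len''.+1 then
         [seq [:: a, a.+1 & J] | J <- paired r' len'' a.+2] else [::])
      ++ paired r len' a.+1
    else [::]
  else [:: [::]].

Arguments paired : simpl never.

(** * Gale evenness and the boundary of the cyclic polytope *)

Section PairedBoundary.
Variable V : zmodType.
Implicit Types f : seq nat -> V.

Lemma paired0 len a : paired 0 len a = [:: [::]].
Proof. by case: len. Qed.

Lemma pairedSS r len a : paired r.+1 len.+2 a =
  [seq [:: a, a.+1 & J] | J <- paired r len a.+2] ++ paired r.+1 len.+1 a.+1.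
Proof. by []. Qed.

Lemma sum_pairedSS r len a f : \sum_(I <- paired r.+1 len.+2 a) f I =
  \sum_(J <- paired r len a.+2) f [:: a, a.+1 & J]
  + \sum_(I <- paired r.+1 len.+1 a.+1) f I.
Proof. by rewrite pairedSS big_cat big_map. Qed.

(** Gale evenness: a face has exactly one odd block of consecutive integers, and arises by deleting
    either the neighbour below or the neighbour above this block, with opposite signs. The faces
    that survive are those whose odd block touches an end of the interval. The induction separates
    the lists that start with [a]. *)
Lemma altdel_paired r len a f :
  \sum_(I <- paired r.+1 len.+1 a) altdel f I =
  \sum_(J <- paired r len a) f (rcons J (a + len)%N)
  - \sum_(J <- paired r len a.+1) f (a :: J).
Proof.
elim/ltn_ind: len r a f => -[|[|len]] IH r a f.
- case: r => [|r]; last by rewrite /paired /= !big_nil subrr.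
  by rewrite /paired /= big_nil !big_seq1 /= addn0 subrr.
- rewrite sum_pairedSS /= [X in _ + X]big_nil addr0.
  case: r => [|r]; last by rewrite /paired /= !big_nil subrr.
  by rewrite !paired0 !big_seq1 /= subr0 addn1.
rewrite sum_pairedSS IH //=.
case: r => [|r].
  rewrite !paired0 !big_seq1 /= subr0 addSnnS -!addrA addrC.
  by rewrite -addrA subrK addrC.
rewrite sum_pairedSS [X in _ = _ - X]sum_pairedSS.
rewrite [X in X + _](_ : _ =
  \sum_(J <- paired r.+1 len.+1 a.+2) f (a.+1 :: J)
  - (\sum_(J <- paired r.+1 len.+1 a.+2) f (a :: J)
     - \sum_(J <- paired r.+1 len.+1 a.+2)
         altdel (fun s => f [:: a, a.+1 & s]) J)); last by rewrite -!sumrB.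
rewrite IH // !addSnnS.
set B := \sum_(J <- paired r.+1 _ _) f (_ :: _).
set A := \sum_(J <- paired r.+1 _ _) f (_ :: _).
set C := \sum_(J <- paired r _ _) _; set D := \sum_(J <- paired r _ _) _.
set E := \sum_(J <- paired r.+1 _ _) _.
have -> : B - (A - (C - D)) = (C - D) - A + B by rewrite opprB addrC.
by rewrite -addrA [B + _]addrC subrK opprD [RHS]addrACA -[LHS]addrA [- A + E]addrC.
Qed.

(* The left-hand side is the boundary of the cyclic polytope on the vertices
   a, ..., a + len + 1, and the right-hand side is the boundary of its pulling
   triangulation from the vertex a. *)
Lemma big_paired_boundary r len a f :
  \sum_(I <- paired r.+1 len.+2 a) f I
    - \sum_(J <- paired r len a.+1) f (a :: rcons J (a + len.+1)%N)
  = \sum_(I <- paired r.+1 len.+1 a.+1) altdel f (a :: I).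
Proof.
rewrite sum_pairedSS /= sumrB (altdel_paired r len a.+1 (fun s => f (a :: s))).
by rewrite opprB addSnnS [X in X - _]addrC -addrA.
Qed.

(** The chain is the boundary of a triangulation, hence a cycle by ∂∂ = 0. *)
Lemma altdel_paired_boundary r len a f :
  \sum_(I <- paired r.+1 len.+2 a) altdel f I
    - \sum_(J <- paired r len a.+1) altdel f (a :: rcons J (a + len.+1)%N) = 0.
Proof.
rewrite (big_paired_boundary r len a (altdel f)).
by rewrite big1 // => I _; rewrite altdelK.
Qed.

End PairedBoundary.

(** * Singular chains on the sphere *)

Section Homologous.
Variables (R : realType) (p d : nat) (A : set 'rV[R]_d).
Implicit Types c : {freeg ('rV[R]_p.+1 -> 'rV[R]_d)}.

Lemma boundaryB (b b' : {freeg ('rV[R]_p.+2 -> 'rV[R]_d)}) :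
  boundary (b - b') = boundary b - boundary b'.
Proof. exact: lift_is_additive. Qed.

Lemma boundary0 : boundary (0 : {freeg ('rV[R]_p.+2 -> 'rV[R]_d)}) = 0.
Proof. by rewrite -(subrr 0) boundaryB subrr. Qed.

Lemma homologous_refl c : homologous A c c.
Proof.
exists 0; first by move=> s; rewrite dom0.
by rewrite subrr boundary0.
Qed.

Lemma homologousB c1 c1' c2 c2' : homologous A c1 c1' ->
  homologous A c2 c2' -> homologous A (c1 - c2) (c1' - c2').
Proof.
move=> [b1 sb1 e1] [b2 sb2 e2]; exists (b1 - b2).
  by move=> s /domB; rewrite mem_cat => /orP[/sb1|/sb2].
by rewrite boundaryB -e1 -e2 !opprB [c2' - c1']addrC addrACA [- c2 + _]addrC.
Qed.

Lemma homologousN c c' : homologous A c c' -> homologous A (- c) (- c').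
Proof. by move/(homologousB (homologous_refl 0)); rewrite !sub0r. Qed.

Lemma homologousD c1 c1' c2 c2' : homologous A c1 c1' ->
  homologous A c2 c2' -> homologous A (c1 + c2) (c1' + c2').
Proof.
by move=> h1 /homologousN h2; have := homologousB h1 h2; rewrite !opprK.
Qed.

Lemma homologous_sym c c' : homologous A c c' -> homologous A c' c.
Proof.
move=> h; have := homologousB (homologous_refl (c + c')) h.
by rewrite addrK [c + c']addrC addrK.
Qed.

Lemma homologous_trans c1 c2 c3 :
  homologous A c1 c2 -> homologous A c2 c3 -> homologous A c1 c3.
Proof.
move=> h12 h23; have := homologousD h12 h23.
move/homologousB => /(_ _ _ (homologous_refl c2)).
by rewrite addrK [c2 + c3]addrC addrK.
Qed.

Lemma homologous_sum (I : Type) (r : seq I) (P : pred I)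
    (F G : I -> {freeg ('rV[R]_p.+1 -> 'rV[R]_d)}) :
  (forall i, P i -> homologous A (F i) (G i)) ->
  homologous A (\sum_(i <- r | P i) F i) (\sum_(i <- r | P i) G i).
Proof.
by move=> FG; elim/big_ind2: _ => // *; [exact: homologous_refl|exact: homologousD].
Qed.

End Homologous.

(** * Radial projections of affine simplices *)

Section RadialSimplex.
Variables (R : realType) (p : nat).
Notation V := 'rV[R]_p.+1.
Implicit Types (l : seq V).

Definition barycenter q (d : nat) (v : nat -> 'rV[R]_d) (t : 'rV[R]_q.+1) : 'rV[R]_d :=
  \sum_(i < q.+1) t 0 i *: v i.

Definition radial_affine q l : 'rV[R]_q.+1 -> V :=
  clip (@radial R p.+1 \o @affine_simplex R q p.+1 (nth 0 l)).

Arguments radial_affine q l _ : clear implicits.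

(** The points of [l] may span a simplex through the origin, where [radial] takes the value 0. The
    chain is still defined formally; only simplices used as fillings have to avoid the origin. *)
Definition rad_chain l : {freeg ('rV[R]_p.+1 -> V)} := << radial_affine p l >>.

Lemma clipE q d (s : 'rV[R]_q.+1 -> 'rV[R]_d) t :
  std_simplex t -> clip s t = s t.
Proof. by move=> st; rewrite /clip patchT // inE. Qed.

Lemma eq_clip q d (s s' : 'rV[R]_q.+1 -> 'rV[R]_d) :
  (forall t, std_simplex t -> s t = s' t) -> clip s = clip s'.
Proof.
move=> ss'; apply/funext => t; rewrite /clip /patch.
by case: ifPn => //; rewrite inE => /ss'.
Qed.

Lemma radial_affineE q l t : std_simplex t ->
  radial_affine q l t = radial (barycenter (nth 0 l) t).
Proof. by move=> st; rewrite /radial_affine clipE //= /affine_simplex clipE. Qed.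

Lemma face_map_simplex q (i : 'I_q.+2) (t : 'rV[R]_q.+1) :
  std_simplex t -> std_simplex (face_map i t).
Proof.
case=> t0 t1; split.
  by move=> j; rewrite mxE; case: unliftP.
rewrite (bigD1_ord i) //= mxE unlift_none add0r -[RHS]t1.
by apply: eq_bigr => j _; rewrite mxE liftK.
Qed.

Lemma nth_del l (i j : nat) : (i < size l)%N ->
  nth 0 (take i l ++ drop i.+1 l) j = nth 0 l (bump i j).
Proof.
move=> il; rewrite nth_cat size_takel ?(ltnW il) // /bump; case: ltnP => ij.
  by rewrite nth_take //= add0n.
by rewrite nth_drop addSn subnKC.
Qed.

Lemma barycenter_face q (d : nat) (v : nat -> 'rV[R]_d) (i : 'I_q.+2) t :
  barycenter v (face_map i t) = barycenter (fun j => v (bump i j)) t.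
Proof.
rewrite /barycenter (bigD1_ord i) //= mxE unlift_none scale0r add0r.
by apply: eq_bigr => j _; rewrite mxE liftK.
Qed.

Lemma boundary_rad l : size l = p.+2 ->
  boundary << radial_affine p.+1 l >> = altdel rad_chain l.
Proof.
move=> sl; rewrite /boundary liftU scale1r altdelE sl; apply: eq_bigr => i _.
rewrite -scaler_int intz; congr (_ *: << _ >>).
apply: eq_clip => t st /=; rewrite radial_affineE; last exact: face_map_simplex.
rewrite barycenter_face /affine_simplex clipE // /barycenter.
by congr radial; apply: eq_bigr => j _; rewrite nth_del ?sl.
Qed.

Lemma continuous_barycenter q (v : nat -> V) :
  continuous (fun t : 'rV[R]_q.+1 => barycenter v t).
Proof.
apply: continuous_big => [|i _ t]; first exact: add_continuous.
by apply: cvgZr_tmp; [exact: (nbhs_filter t)|exact: coord_continuous].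
Qed.

Lemma enorm_gt0 d (x : 'rV[R]_d) : x != 0 -> 0 < enorm x.
Proof.
move=> x0; rewrite sqrtr_gt0 lt_neqAle sumr_ge0 ?andbT => [|i _]; last exact: sqr_ge0.
apply: contra x0; rewrite eq_sym psumr_eq0 => [/allP h|i _]; last exact: sqr_ge0.
apply/eqP/rowP => i; rewrite mxE.
by apply/eqP; rewrite -sqrf_eq0; apply: h; rewrite mem_index_enum.
Qed.

Lemma radial_sphere d (x : 'rV[R]_d) : x != 0 -> sphere (radial x).
Proof.
move=> x0; rewrite /sphere /= /radial {1}/enorm.
under eq_bigr do rewrite mxE exprMn.
rewrite -mulr_sumr sqrtrM ?sqr_ge0 // sqrtr_sqr -/(enorm x).
have := enorm_gt0 x0 => e0; rewrite ger0_norm ?invr_ge0 ?ltW //.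
by rewrite mulVf // gt_eqF.
Qed.

Lemma continuous_enorm d : continuous (@enorm R d).
Proof.
move=> x; apply: (continuous_comp _ (@sqrt_continuous R _)).
apply: continuous_big => [|i _ {}x]; first exact: add_continuous.
by apply: (continuous_comp _ (@exprn_continuous R 2 _)); exact: coord_continuous.
Qed.

Lemma radial_affine_singular q l :
  (forall t : 'rV[R]_q.+1, std_simplex t -> barycenter (nth 0 l) t != 0) ->
  singular_simplex (@sphere R p.+1) (radial_affine q l).
Proof.
move=> l0; split.
- by apply: eq_clip => t st; rewrite /radial_affine clipE.
- apply: (@subspace_eq_continuous _ _ _ (fun t => radial (barycenter (nth 0 l) t))).
    by move=> t; rewrite inE => st; rewrite [RHS](radial_affineE l st).
  apply/subspace_continuousP => t st; apply: cvg_within_filter.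
  have cb := @continuous_barycenter q (nth 0 l) t.
  apply: cvgZ => //; apply: cvgV; first by rewrite gt_eqF // enorm_gt0 // l0.
  exact: (continuous_comp cb (@continuous_enorm _ _)).
- move=> _ [t st <-]; rewrite radial_affineE //.
  by apply: radial_sphere; exact: l0.
Qed.

(** A simplex that misses the origin projects to a singular simplex of the sphere, and the
    projection commutes with taking faces. *)
Lemma altdel_rad_null l : size l = p.+2 ->
  (forall t : 'rV[R]_p.+2, std_simplex t -> barycenter (nth 0 l) t != 0) ->
  homologous (@sphere R p.+1) (altdel rad_chain l) 0.
Proof.
move=> sl l0; exists << radial_affine p.+1 l >>.
  by move=> s; rewrite domU1 inE => /eqP ->; exact: radial_affine_singular.
by rewrite subr0 boundary_rad.
Qed.

End RadialSimplex.
Arguments radial_affine {R p} q l _.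

(** * The Cauchy-Binet formula and Laplace expansion *)

Section CauchyBinet.
Variables (R : comNzRingType) (q n : nat) (M : 'M[R]_(q, n)) (Z : 'M[R]_(n, q)).

Lemma det_mulmx_ffun : \det (M *m Z) =
  \sum_(f : {ffun 'I_q -> 'I_n}) (\prod_i M i (f i)) * \det (rowsub f Z).
Proof.
rewrite /determinant.
under eq_bigr => s _.
  under eq_bigr do rewrite mxE.
  rewrite bigA_distr_bigA /= mulr_sumr.
  over.
rewrite exchange_big; apply: eq_bigr => f _ /=.
rewrite mulr_sumr; apply: eq_bigr => s _; rewrite big_split mulrCA /=.
by congr (_ * (_ * _)); apply: eq_bigr => i _; rewrite mxE.
Qed.

Lemma det_rowsub_perm (f : 'I_q -> 'I_n) (s : 'S_q) :
  \det (rowsub (f \o s) Z) = (-1) ^+ s * \det (rowsub f Z).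
Proof.
rewrite -det_perm -det_mulmx; congr (\det _).
rewrite -row_permE; apply/matrixP => i j; by rewrite !mxE.
Qed.

(* Summing over all maps rather than over subsets counts each subset q! times,
   since both determinants change sign together under a permutation. *)
Lemma cauchy_binet_ffun : q`!%:R * \det (M *m Z) =
  \sum_(f : {ffun 'I_q -> 'I_n}) \det (colsub f M) * \det (rowsub f Z).
Proof.
have -> : q`!%:R * \det (M *m Z) = \sum_(s : 'S_q) \det (M *m Z).
  by rewrite sumr_const card_Sn mulr_natl.
under [RHS]eq_bigr => f _ do rewrite /(\det (colsub f M)) mulr_suml.
rewrite [RHS]exchange_big; apply: eq_bigr => s _ /=.
rewrite det_mulmx_ffun.
have bij : bijective (fun f : {ffun 'I_q -> 'I_n} => [ffun i => f (s i)]).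
  exists (fun f : {ffun 'I_q -> 'I_n} => [ffun i => f (s^-1%g i)]) => f;
    by apply/ffunP => i; rewrite !ffunE ?permK ?permKV.
rewrite (reindex _ (onW_bij _ bij)) /=; apply: eq_bigr => f _.
rewrite -mulrA mulrCA -det_rowsub_perm; congr (_ * _).
  by apply: eq_bigr => i _; rewrite ffunE mxE.
by congr (\det _); apply/matrixP => i j; rewrite !mxE ffunE.
Qed.

End CauchyBinet.

(** * Laplace expansion along unit rows *)

Section LaplaceComplement.
Variable R : comNzRingType.

(* [B] on top of the unit row vectors e_(L 0), e_(L 1), ...  The entries are
   indexed by [nat], so that removing a column is a composition with [bump]. *)
Definition unit_rows_mx (k N : nat) (B : nat -> nat -> R) (L : nat -> nat) :
    'M[R]_N :=
  \matrix_(i, j) if (i < k)%N then B i j else (j == L (i - k)%N :> nat)%:R.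

(** [H] enumerates the complement of [L]. The expansion starts from the last unit row: since [L] is
    increasing, removing column [L m] does not renumber the columns of the other unit entries, and
    each step contributes the sign of row [k + a] and column [L a]. *)
Lemma det_unit_rows k m (L : nat -> nat) :
  (forall a b, (a < b < m)%N -> (L a < L b)%N) ->
  (forall a, (a < m)%N -> (L a < k + m)%N) ->
  exists H : nat -> nat, [/\ {homo H : i j / (i < j)%N},
    forall j, (j < k)%N -> (H j < k + m)%N,
    forall j a, (a < m)%N -> H j != L a
    & forall B, \det (unit_rows_mx k (k + m) B L) =
        (-1) ^+ (\sum_(a < m) (k + a + L a)) * \det (\matrix_(i < k, j < k) B i (H j))].
Proof.
elim: m => [|m IH] Linc Llt.
  exists id; split => //= [j|B]; first by rewrite addn0.
  rewrite big_ord0 expr0 mul1r addn0; congr (\det _); apply/matrixP => i j.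
  by rewrite !mxE ltn_ord.
have Lam a : (a < m)%N -> (L a < L m)%N by move=> am; apply: Linc; rewrite am ltnSn.
have Lm : (L m < k + m.+1)%N by apply: Llt.
have [||H [Hinc Hlt HL HB]] := IH.
- by move=> a b /andP[ab bm]; apply: Linc; rewrite ab ltnW.
- by move=> a am; have := Lam _ am; lia.
exists (fun j => bump (L m) (H j)); split.
- by move=> i j /Hinc; rewrite /bump; lia.
- by move=> j /Hlt; rewrite /bump; lia.
- move=> j a; rewrite ltnS leq_eqVlt => /orP[/eqP->|am]; first by rewrite eq_sym neq_bump.
  by have := HL j a am; have := Lam _ am; rewrite /bump; lia.
move=> B; rewrite big_ord_recr /= exprD -mulrA mulrCA.
rewrite -(HB (fun i j => B i (bump (L m) j))).
rewrite addnS in Lm *; set M := (X in \det X = _).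
have Mmax j : M ord_max j = (j == L m :> nat)%:R.
  by rewrite mxE /= ltnNge leq_addr addKn.
rewrite (expand_det_row _ ord_max) (bigD1 (Ordinal Lm)) //= big1 ?addr0 => [|j jL].
  rewrite Mmax eqxx mul1r /cofactor /=; congr (_ * _); congr (\det _).
  apply/matrixP => i j; rewrite 2!mxE [LHS]mxE [RHS]mxE lift_max /=.
  case: ltnP => // ki; congr ((_ : bool)%:R).
  have im : (i - k < m)%N by have := ltn_ord i; lia.
  by have := Lam _ im; rewrite /bump; lia.
by rewrite Mmax; have -> : (j == L m :> nat) = false; [exact: negbTE|rewrite mul0r].
Qed.

End LaplaceComplement.

(** * Generation of GL^+ by elementary matrices *)

Section ElementaryGeneration.
Variable F : realFieldType.

Definition elem_mx m (i j : 'I_m) (a : F) : 'M[F]_m := 1%:M + a *: delta_mx i j.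

(** For [i = j] the matrix [elem_mx i j a] rescales one coordinate by [1 + a], so the condition
    [-1 < a] keeps the determinant positive. Multiplication on the left changes a single row. *)
Inductive elem_gen m : 'M[F]_m -> Prop :=
| elem_gen1 : elem_gen 1%:M
| elem_genM i j a g : (i == j) ==> (-1 < a) -> elem_gen g ->
    elem_gen (elem_mx i j a *m g).

Lemma elem_gen_mul m (g h : 'M[F]_m) :
  elem_gen g -> elem_gen h -> elem_gen (g *m h).
Proof.
move=> gg gh; elim: gg => [|i j a k hij gk IH]; first by rewrite mul1mx.
by rewrite -mulmxA; exact: elem_genM.
Qed.

Lemma elem_gen_mx m (i j : 'I_m) a : (i == j) ==> (-1 < a) ->
  elem_gen (elem_mx i j a).
Proof. by move=> h; rewrite -[elem_mx i j a]mulmx1; apply: elem_genM => //; left. Qed.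

Lemma elem_mxK m (i j : 'I_m) a (g : 'M[F]_m) : i != j ->
  elem_mx i j (- a) *m (elem_mx i j a *m g) = g.
Proof.
move=> ij; rewrite mulmxA /elem_mx mulmxDl mul1mx mulmxDr mulmx1.
rewrite -scalemxAl -scalemxAr mul_delta_mx_cond eq_sym (negbTE ij) mulr0n !scaler0.
by rewrite addr0 scaleNr addrK mul1mx.
Qed.

Lemma elem_gen_lift m (g : 'M[F]_m) : elem_gen g ->
  elem_gen (block_mx 1%:M 0 0 g : 'M[F]_(1 + m)).
Proof.
elim=> [|i j a h hij gh IH]; first by rewrite -scalar_mx_block; left.
have -> : block_mx 1%:M 0 0 (elem_mx i j a *m h) =
    elem_mx (rshift 1 i) (rshift 1 j) a *m (block_mx 1%:M 0 0 h) :> 'M[F]_(1 + m).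
  have -> : elem_mx (rshift 1 i) (rshift 1 j) a = block_mx 1%:M 0 0 (elem_mx i j a).
    rewrite /elem_mx scalar_mx_block.
    have -> : delta_mx (rshift 1 i) (rshift 1 j) =
        block_mx 0 0 0 (delta_mx i j) :> 'M[F]_(1 + m).
      apply/matrixP => x y.
      case: (split_ordP x) => x' ->; case: (split_ordP y) => y' ->;
        by rewrite ?block_mxEul ?block_mxEur ?block_mxEdl ?block_mxEdr !mxE
           ?eq_lrshift ?eq_rlshift ?eq_rshift ?andbF.
    by rewrite scale_block_mx add_block_mx !scaler0 !addr0.
  by rewrite mulmx_block !mulmx0 !mul0mx !mulmx1 !addr0 !add0r.
by apply: elem_genM => //; rewrite eq_rshift.
Qed.

Lemma elem_gen_lower m (v : 'cV[F]_m) :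
  elem_gen (block_mx 1%:M 0 v 1%:M : 'M[F]_(1 + m)).
Proof.
rewrite [v]matrix_sum_delta; under eq_bigr do rewrite big_ord1.
elim/big_rec: _ => [|i w _ gw]; first by rewrite -scalar_mx_block; left.
have -> : block_mx 1%:M 0 (v i 0 *: delta_mx i 0 + w) 1%:M =
    elem_mx (rshift 1 i) (lshift m ord0) (v i 0) *m
      block_mx 1%:M 0 w 1%:M :> 'M[F]_(1 + m).
  have -> : elem_mx (rshift 1 i) (lshift m ord0) (v i 0) =
      block_mx 1%:M 0 (v i 0 *: delta_mx i 0) 1%:M.
    rewrite /elem_mx scalar_mx_block.
    have -> : delta_mx (rshift 1 i) (lshift m ord0) =
        block_mx 0 0 (delta_mx i 0) 0 :> 'M[F]_(1 + m).
      apply/matrixP => x y.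
      case: (split_ordP x) => x' ->; case: (split_ordP y) => y' ->;
        by rewrite ?block_mxEul ?block_mxEur ?block_mxEdl ?block_mxEdr !mxE
           ?eq_lrshift ?eq_rlshift ?eq_rshift ?eq_lshift ?andbF.
    by rewrite scale_block_mx add_block_mx !scaler0 !addr0 add0r.
  by rewrite mulmx_block !mulmx0 !mul0mx !mulmx1 !mul1mx !addr0 !add0r.
by apply: elem_genM => //; rewrite eq_rlshift.
Qed.

Lemma elem_gen_upper m (u : 'rV[F]_m) :
  elem_gen (block_mx 1%:M u 0 1%:M : 'M[F]_(1 + m)).
Proof.
rewrite [u]matrix_sum_delta big_ord1.
elim/big_rec: _ => [|i w _ gw]; first by rewrite -scalar_mx_block; left.
have -> : block_mx 1%:M (u 0 i *: delta_mx 0 i + w) 0 1%:M =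
    elem_mx (lshift m ord0) (rshift 1 i) (u 0 i) *m
      block_mx 1%:M w 0 1%:M :> 'M[F]_(1 + m).
  have -> : elem_mx (lshift m ord0) (rshift 1 i) (u 0 i) =
      block_mx 1%:M (u 0 i *: delta_mx 0 i) 0 1%:M.
    rewrite /elem_mx scalar_mx_block.
    have -> : delta_mx (lshift m ord0) (rshift 1 i) =
        block_mx 0 (delta_mx 0 i) 0 0 :> 'M[F]_(1 + m).
      apply/matrixP => x y.
      case: (split_ordP x) => x' ->; case: (split_ordP y) => y' ->;
        by rewrite ?block_mxEul ?block_mxEur ?block_mxEdl ?block_mxEdr !mxE
           ?eq_lrshift ?eq_rlshift ?eq_rshift ?eq_lshift ?andbF.
    by rewrite scale_block_mx add_block_mx !scaler0 !addr0 add0r.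
  by rewrite mulmx_block !mulmx0 !mul0mx !mulmx1 !mul1mx !addr0 !add0r addrC.
by apply: elem_genM => //; rewrite eq_lrshift.
Qed.

Lemma elem_mx_mulE m (i j : 'I_m) a (g : 'M[F]_m) x y :
  (elem_mx i j a *m g) x y = g x y + (if x == i then a * g j y else 0).
Proof.
rewrite mulmxDl mul1mx mxE -scalemxAl mxE; congr (_ + _).
rewrite mxE (bigD1 j) //= mxE eqxx andbT big1 ?addr0 => [|k kj].
  by case: eqP; rewrite ?mul1r ?mul0r ?mulr0.
by rewrite mxE (negbTE kj) andbF mul0r.
Qed.

Lemma det_elem_mx_mul m (i j : 'I_m) a (g : 'M[F]_m) : i != j ->
  \det (elem_mx i j a *m g) = \det g.
Proof.
move=> ij; pose h : 'M[F]_m := \matrix_(x, y) g (if x == i then j else x) y.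
rewrite (@determinant_multilinear _ _ _ g h i 1 a).
- rewrite mul1r (determinant_alternate (i1 := i) (i2 := j) (A := h)) //.
    by rewrite mulr0 addr0.
  move=> y.
  by rewrite !mxE eqxx eq_sym (negbTE ij).
- by apply/rowP => y; rewrite [LHS]mxE elem_mx_mulE eqxx !mxE eqxx mul1r.
- apply/matrixP => x y; rewrite [RHS]mxE elem_mx_mulE !mxE.
  by rewrite eq_sym (negbTE (neq_lift _ _)) addr0.
- apply/matrixP => x y; rewrite [RHS]mxE elem_mx_mulE !mxE.
  by rewrite eq_sym (negbTE (neq_lift _ _)) addr0.
Qed.

Lemma elem_gen_mulP m (i j : 'I_m) a (g : 'M[F]_m) : i != j ->
  elem_gen (elem_mx i j a *m g) -> elem_gen g.
Proof.
move=> ij gg; rewrite -(elem_mxK a g ij).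
by apply: elem_genM => //; rewrite (negbTE ij).
Qed.

(** Gaussian elimination: with corner entry 1, the matrix is the product of a lower unipotent
    matrix, a block diagonal matrix with blocks 1 and the Schur complement, and an upper unipotent
    matrix; induction applies to the Schur complement. *)
Lemma elem_gen_det m (g : 'M[F]_m) : 0 < \det g -> elem_gen g.
Proof.
elim: m g => [|m IH] g dg.
  by rewrite (_ : g = 1%:M); [left | apply/matrixP => -[]].
have pivot (h : 'M[F]_(1 + m)) : 0 < \det h -> h 0 0 = 1 -> elem_gen h.
  move=> dh h1; rewrite -[h]submxK.
  have -> : ulsubmx h = 1%:M.
    by apply/matrixP => x y; rewrite !ord1 !mxE !eqxx lshift0.
  set u := ursubmx h; set v := dlsubmx h; set w := drsubmx h.
  have E : block_mx 1%:M u v w = block_mx 1%:M 0 v 1%:M *m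
      (block_mx 1%:M 0 0 (w - v *m u) *m block_mx 1%:M u 0 1%:M) :> 'M[F]_(1 + m).
    rewrite !mulmx_block !mulmx0 !mul0mx !mulmx1 !mul1mx !addr0 ?add0r.
    by rewrite [v *m u + _]addrC subrK mulmx1.
  have dw : 0 < \det (w - v *m u).
    have := dh; rewrite -[h]submxK -/u -/v -/w.
    have -> : ulsubmx h = 1%:M.
      by apply/matrixP => x y; rewrite !ord1 !mxE !eqxx lshift0.
    by rewrite E !det_mulmx det_lblock det_ublock det_ublock !det1 !mul1r !mulr1.
  rewrite E; apply: elem_gen_mul; first exact: elem_gen_lower.
  by apply: elem_gen_mul; [apply: elem_gen_lift; exact: IH | exact: elem_gen_upper].
have below (h : 'M[F]_(1 + m)) (i : 'I_(1 + m)) :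
    0 < \det h -> i != 0 -> h i 0 != 0 -> elem_gen h.
  (* The coefficient is chosen to make the corner entry equal to 1. *)
  move=> dh i0 hi; apply: (@elem_gen_mulP _ 0 i ((1 - h 0 0) / h i 0)).
    by rewrite eq_sym.
  apply: pivot; first by rewrite det_elem_mx_mul // eq_sym.
  by rewrite elem_mx_mulE eqxx divfK // addrC subrK.
have [/existsP[i /andP[i0 gi]]|/existsPn g0] :=
  boolP [exists i : 'I_(1 + m), (i != 0) && (g i 0 != 0)]; first exact: (below g i).
have g00 : g 0 0 != 0.
  apply: contraTneq dg => g00; rewrite (expand_det_col _ 0) big1 ?ltxx // => i _.
  have [->|i0] := eqVneq i 0; first by rewrite g00 mul0r.
  by have := g0 i; rewrite i0 /= negbK => /eqP ->; rewrite mul0r.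
(* The first column now vanishes below the corner. In size 1 the matrix is itself a rescaling;
   otherwise adding row 0 to row 1 creates a nonzero entry below the corner. *)
case: m {IH pivot} g dg below g0 g00 => [|m] g dg below g0 g00.
  have -> : g = elem_mx 0 0 (g 0 0 - 1).
    by apply/matrixP => x y; rewrite !ord1 !mxE !eqxx mulr1 addrC subrK.
  apply: elem_gen_mx; rewrite eqxx ltrBrDl subrr /=.
  by have := dg; rewrite det_mx11.
apply: (@elem_gen_mulP _ (lift 0 0) 0 1) => //; apply: (below _ (lift 0 0)) => //.
  by rewrite det_elem_mx_mul.
rewrite elem_mx_mulE eqxx mul1r.
by have := g0 (lift 0 0); rewrite /= negbK => /eqP ->; rewrite add0r.
Qed.

End ElementaryGeneration.

(** * Local degree of a simplex around the origin *)

Section LocalDegree.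
Variables (R : realType) (p : nat).
Notation V := 'rV[R]_p.+1.
Implicit Types (l : seq V) (g : 'M[R]_p.+1).
Notation "c ~~ c'" := (homologous (@sphere R p.+1) c c') (at level 70).
Notation rad := (@rad_chain R p).

Lemma homologousMsign i (c1 c2 : {freeg ('rV[R]_p.+1 -> V)}) :
  c1 ~~ c2 -> c1 *~ (-1) ^+ i ~~ c2 *~ (-1) ^+ i.
Proof.
move=> h; rewrite -signr_odd; case: odd; rewrite ?expr1 ?expr0 ?mulr1z //.
by rewrite !mulrN1z; exact: homologousN.
Qed.

(** In ∂∂ of the simplex on all [p.+3] points, the faces opposite to the points outside [P] miss the
    origin by hypothesis, so their boundaries are null-homologous; hence so is the remaining sum. *)
Lemma altdel2_null l (P : pred 'I_p.+3) : size l = p.+3 ->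
  (forall (i : 'I_p.+3) (w : 'I_p.+3 -> R), ~~ P i -> (forall h, 0 <= w h) ->
     w i = 0 -> \sum_h w h *: nth 0 l h = 0 -> forall h, w h = 0) ->
  \sum_(i < p.+3 | P i) altdel rad (take i l ++ drop i.+1 l) *~ (-1) ^+ i ~~ 0.
Proof.
move=> sl cond.
have := altdelK rad l; rewrite altdelE sl (bigID P) /=.
set A := \sum_(i < _ | P i) _; set B := \sum_(i < _ | _) _ => AB0.
have -> : A = 0 - B by rewrite -AB0 addrK.
rewrite -[X in _ ~~ X]subr0; apply: homologousB; first exact: homologous_refl.
have <- : \sum_(i < p.+3 | ~~ P i) (0 : {freeg ('rV[R]_p.+1 -> V)}) = 0.
  by rewrite big1.
apply: homologous_sum => i Pi.
have <- : (0 : {freeg ('rV[R]_p.+1 -> V)}) *~ (-1) ^+ i = 0 by rewrite mul0rz.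
apply: homologousMsign; apply: altdel_rad_null => [|t st].
  have il := ltn_ord i.
  by rewrite size_cat size_drop size_takel sl; lia.
have -> : barycenter (nth 0 (take i l ++ drop i.+1 l)) t =
    barycenter (nth 0 l) (face_map i t).
  rewrite barycenter_face; apply: eq_bigr => j _.
  by rewrite nth_del // sl.
have [w0 w1] := face_map_simplex i st.
apply/eqP => bary0; have /= w0' := cond i (fun h => face_map i t 0 h) Pi w0 _ bary0.
move/eqP: w1; rewrite big1 ?(eq_sym 0) ?oner_eq0 // => h _; apply: w0'.
by rewrite mxE unlift_none.
Qed.

(* The boundary of the boundary of [.., l_j, b, ..] vanishes, and the faces that
   contain both l_j and b do not contain the origin. *)
Lemma rad_replace l (j : 'I_p.+2) (b : V) : size l = p.+2 ->
  (forall (s : 'I_p.+2 -> R) (t : R) (i : 'I_p.+2), (forall k, 0 <= s k) ->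
     0 <= t -> i != j -> s i = 0 ->
     \sum_k s k *: nth 0 l k + t *: b = 0 -> t = 0 /\ forall k, s k = 0) ->
  altdel rad (set_nth 0 l j b) ~~ altdel rad l.
Proof.
(* Deleting entry [j] of [L] puts [b] in place of the [j]-th point of [l]; deleting entry [j.+1]
   gives back [l]. *)
move=> sl cond; pose L := take j l ++ nth 0 l j :: b :: drop j.+1 l.
have jl : (j < size l)%N by rewrite sl.
have sL : size L = p.+3.
  by rewrite size_cat /= size_drop size_takel ?(ltnW jl) // sl; have := ltn_ord j; lia.
pose j0 : 'I_p.+3 := widen_ord (leqnSn _) j; pose j1 : 'I_p.+3 := lift ord0 j.
have j1E : j1 = j.+1 :> nat by [].
have Lj1 : nth 0 L j1 = b.
  rewrite nth_cat size_takel ?(ltnW jl) // j1E ltnNge leqnSn /=.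
  by rewrite subSn // subnn.
have Llift (k : 'I_p.+2) : nth 0 L (lift j1 k) = nth 0 l k.
  rewrite -[in RHS](cat_take_drop j l) !nth_cat !size_takel ?(ltnW jl) //.
  have -> : lift j1 k = bump j.+1 k :> nat by [].
  rewrite /bump; case: (ltngtP j k) => jk.
  - rewrite add1n ltnNge (leqW (ltnW jk)) /=.
    rewrite (drop_nth 0 jl) !subSn ?(ltnW jk) //=.
    by have -> : (k - j = (k - j.+1).+1)%N by lia.
  - by rewrite add0n jk.
  - by rewrite -jk add0n ltnn subnn (drop_nth 0 jl).
have delj0 : take j0 L ++ drop j0.+1 L = set_nth 0 l j b.
  rewrite set_nthE jl /L /= take_size_cat ?size_takel ?(ltnW jl) //.
  by rewrite drop_cat size_takel ?(ltnW jl) // ltnNge leqnSn /= subSn // subnn /= ?drop0.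
have delj1 : take j1 L ++ drop j1.+1 L = l.
  rewrite /L j1E -cat1s catA -[b :: _]cat1s !catA.
  have s1 : size (take j l ++ [:: nth 0 l j]) = j.+1.
    by rewrite size_cat size_takel ?(ltnW jl) //= addn1.
  rewrite -catA take_size_cat // drop_cat s1 ltnNge leqnSn /= subSn // subnn /= ?drop0.
  by rewrite -catA /= -(drop_nth 0 jl) cat_take_drop.
have j01 : j0 != j1 by apply/eqP => /(congr1 val) /=; rewrite /bump /=; lia.
have := @altdel2_null L (fun i => (i == j0) || (i == j1)) sL.
rewrite (bigD1 j0) ?eqxx //= (bigD1 j1) /=; last by rewrite eqxx orbT eq_sym.
rewrite big1 ?addr0 => [|i]; last by do 2!case: eqP.
rewrite delj0 delj1 (_ : bump 0 j = j.+1) // exprS mulN1r mulrNz => H.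
have {H} : (altdel rad (set_nth 0 l j b) - altdel rad l) *~ (-1) ^+ j ~~ 0.
  rewrite mulrzBl; apply: H => i w; rewrite negb_or => /andP[ij0 ij1] w0 wi.
  rewrite (bigD1_ord j1) //= Lj1.
  under eq_bigr do rewrite Llift.
  case: (unliftP j1 i) ij1 => [i' ei|-> /eqP//] _.
  rewrite addrC => /(cond (fun k => w (lift j1 k)) _ i') [] //.
  - apply: contra ij0 => /eqP i'j; rewrite ei -val_eqE /= i'j.
    by rewrite /bump /= add1n ltnn.
  - by rewrite -ei.
  by move=> wj1 wl h; case: (unliftP j1 h) => [h' ->|->].
move/(homologousMsign j); rewrite mul0rz -mulrzA -exprMn mulrNN mulr1 expr1n mulr1z.
by move/(homologousD (homologous_refl _ (altdel rad l))); rewrite addrC subrK addr0.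
Qed.

End LocalDegree.

(** * Simplices formed by a basis and an apex *)

Section ConeDegree.
Variables (R : realType) (p : nat).
Notation V := 'rV[R]_p.+1.
Implicit Types (l : seq V) (g : 'M[R]_p.+1).
Notation "c ~~ c'" := (homologous (@sphere R p.+1) c c') (at level 70).
Notation rad := (@rad_chain R p).

Definition row_list m n (g : 'M[R]_(m, n)) : seq 'rV[R]_n :=
  [seq row i g | i <- enum 'I_m].

Lemma size_row_list m n (g : 'M[R]_(m, n)) : size (row_list g) = m.
Proof. by rewrite size_map size_enum_ord. Qed.

Lemma nth_row_list m n (g : 'M[R]_(m, n)) (i : 'I_m) :
  nth 0 (row_list g) i = row i g.
Proof. by rewrite (nth_map i) ?size_enum_ord // nth_ord_enum. Qed.

Lemma set_nth_row_list m n (g : 'M[R]_(m, n)) (i : 'I_m) (u : 'rV_n) :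
  set_nth 0 (row_list g) i u =
  row_list (\matrix_k if k == i then u else row k g).
Proof.
apply: (@eq_from_nth _ 0).
  by rewrite size_set_nth !size_row_list; apply/maxn_idPr.
move=> j; rewrite size_set_nth size_row_list (maxn_idPr (ltn_ord i)) => jm.
rewrite nth_set_nth /= -[j]/(val (Ordinal jm)) !nth_row_list rowK -val_eqE.
by case: eqP.
Qed.

Lemma sum_cone g (x : V) (s : 'I_p.+2 -> R) :
  \sum_k s k *: nth 0 (x :: row_list g) k =
  s ord0 *: x + (\row_k s (lift ord0 k)) *m g.
Proof.
rewrite big_ord_recl /= mulmx_sum_row; congr (_ + _).
by apply: eq_bigr => k _; rewrite nth_row_list mxE.
Qed.

Lemma mulmx_unit_eq0 (v : V) g : \det g != 0 -> v *m g = 0 -> v = 0.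
Proof.
move=> dg vg; have ug : g \in unitmx by rewrite unitmxE unitfE.
by rewrite -(mulmxK ug v) vg mul0mx.
Qed.

(** Both apexes lie in the open cone opposite to the rows of [g], so a simplex that contains both
    but omits a row misses the origin. *)
Lemma rad_replace_apex g (c c' : V) : \det g != 0 ->
  (forall k, 0 < c 0 k) -> (forall k, 0 < c' 0 k) ->
  altdel rad (- (c' *m g) :: row_list g) ~~ altdel rad (- (c *m g) :: row_list g).
Proof.
move=> dg c0 c'0.
apply: (@rad_replace _ _ (- (c *m g) :: row_list g) ord0 (- (c' *m g))) =>
  [|s t i s0 t0].
  by rewrite /= size_row_list.
case: (unliftP ord0 i) => [k ->|-> /eqP//] _ sk.
rewrite sum_cone -!mulNmx !scalemxAl addrAC -!mulmxDl => /(mulmx_unit_eq0 dg) /rowP e.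
have es j : s (lift ord0 j) = s ord0 * c 0 j + t * c' 0 j.
  by have := e j; rewrite !mxE => ej; lra.
have [st t00] : s ord0 = 0 /\ t = 0.
  have := es k; rewrite sk => /esym/eqP.
  rewrite paddr_eq0 ?mulr_ge0 ?(ltW (c0 _)) ?(ltW (c'0 _)) //.
  by rewrite !mulf_eq0 !(gt_eqF (c0 _), gt_eqF (c'0 _)) !orbF => /andP[/eqP-> /eqP->].
split=> // j; case: (unliftP ord0 j) => [j' ->|->] //.
by rewrite es st t00 !mul0r addr0.
Qed.

(** When [e *m g] replaces row [i] of the basis, [c] acquires the coefficients [c_i / e_i] and
    [c_k - c_i e_k / e_i]. The hypotheses make them positive, so the apex remains opposite to the
    rows. *)
Lemma rad_replace_row g (c e : V) (i : 'I_p.+1) : \det g != 0 ->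
  (forall k, 0 < c 0 k) -> 0 < e 0 i ->
  (forall k, k != i -> c 0 i * e 0 k < c 0 k * e 0 i) ->
  altdel rad (- (c *m g) :: set_nth 0 (row_list g) i (e *m g)) ~~
  altdel rad (- (c *m g) :: row_list g).
Proof.
move=> dg c0 ei ce.
apply: (@rad_replace _ _ (- (c *m g) :: row_list g) (lift ord0 i) (e *m g)) =>
  [|s t h s0 t0 hi sh].
  by rewrite /= size_row_list.
rewrite sum_cone -!mulNmx !scalemxAl -!mulmxDl => /(mulmx_unit_eq0 dg) /rowP eq.
have es j : s (lift ord0 j) + t * e 0 j = s ord0 * c 0 j.
  by have := eq j; rewrite !mxE => ej; lra.
have st : s ord0 = 0.
  case: (unliftP ord0 h) hi sh => [k ->|->] //.
  rewrite (inj_eq (@lift_inj _ _)) => ki sk.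
  have := es k; rewrite sk add0r => ek; have ei' := es i.
  have := ce _ ki; have := c0 k; have := c0 i; have := s0 ord0; have := s0 (lift ord0 i).
  move: ek ei' ei t0.
  move: (s ord0) (s (lift ord0 i)) (c 0 i) (c 0 k) (e 0 i) (e 0 k) => S si a b u v.
  move=> tv tu u0 t0 si0 S0 a0 b0 lt.
  (* A positive [S] would give [t v = S b] and [t u <= S a], hence [b u <= a v], against [lt]. *)
  apply/eqP; rewrite eq_le S0 andbT leNgt; apply/negP => Sp.
  have tp : 0 < t * v by rewrite tv mulr_gt0.
  have v0 : 0 < v by nra.
  have : t * u * v <= S * a * v by apply: ler_wpM2r; [exact: ltW|lra].
  have : S * (a * v) < S * (b * u) by rewrite ltr_pM2l.
  have -> : t * u * v = S * b * u by rewrite -tv; ring.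
  by rewrite !mulrA; lra.
have [si ti] : s (lift ord0 i) = 0 /\ t = 0.
  have := es i; rewrite st mul0r => /eqP.
  rewrite paddr_eq0 ?mulr_ge0 ?(ltW ei) //.
  by rewrite mulf_eq0 (gt_eqF ei) orbF => /andP[/eqP-> /eqP->].
split=> // j; case: (unliftP ord0 j) => [j' ->|->] //.
by have := es j'; rewrite st ti !mul0r addr0.
Qed.

Lemma elem_mx_row m (i j : 'I_m) a :
  row i (elem_mx i j a) = delta_mx 0 i + a *: delta_mx 0 j :> 'rV[R]_m.
Proof. by apply/rowP => k; rewrite !mxE !eqxx /= eq_sym. Qed.

Lemma mul_row_elem_mx m (c : 'rV[R]_m) (i j : 'I_m) a k :
  (c *m elem_mx i j a) 0 k = c 0 k + (if k == j then c 0 i * a else 0).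
Proof.
rewrite /elem_mx mulmxDr mulmx1 mxE; congr (_ + _).
rewrite mxE (bigD1 i) //= big1 => [|h hi]; last first.
  by rewrite !mxE (negbTE hi) !mulr0.
by rewrite !mxE eqxx addr0 /=; case: eqP; rewrite ?mulr1 ?mulr0.
Qed.

(** For invertible [g] the origin is interior to these simplices. All positive [c] are allowed so
    that a row operation can start from a convenient apex. *)
Definition has_degree_one g := forall c : V, (forall k, 0 < c 0 k) ->
  altdel rad (- (c *m g) :: row_list g) ~~ sphere_class R p.+1.

Lemma has_degree_one_elem i j a g : (i == j) ==> (-1 < a) -> \det g != 0 ->
  \det (elem_mx i j a *m g) != 0 ->
  has_degree_one g -> has_degree_one (elem_mx i j a *m g).
Proof.
set E := elem_mx i j a => ija dg dg' hg c' c'0.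
(* The entry at [j] exceeds [|a|], which makes [c = c0 *m E] positive. The vectors [c0] for [E *m g]
   and [c] for [g] define the same apex, so only row [i] has to be replaced. *)
pose c0 : V := \row_k (1 + (k == j)%:R * `|a|).
have c00 k : 0 < c0 0 k by rewrite mxE; have := normr_ge0 a; case: eqP => _ /= ?; lra.
apply: homologous_trans (rad_replace_apex dg' c00 c'0) _.
pose c := c0 *m E; pose e : V := row i E.
have cE k : c 0 k = c0 0 k + (if k == j then c0 0 i * a else 0) by exact: mul_row_elem_mx.
have eE k : e 0 k = (k == i)%:R + (k == j)%:R * a.
  by rewrite /e elem_mx_row !mxE !eqxx /= mulrC.
have ei : 0 < e 0 i.
  rewrite eE eqxx; case: eqP ija => [_|_ _]; rewrite ?implyTb /=; lra.
have cek k : k != i -> c 0 k = c0 0 k + c0 0 i * e 0 k.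
  move=> ki; rewrite cE eE (negbTE ki) add0r.
  by case: eqP => _; rewrite ?mul1r ?mul0r ?mulr0.
have cei : c 0 i = c0 0 i * e 0 i.
  by rewrite cE eE eqxx; case: eqP => _ /=; ring.
have c_gt0 k : 0 < c 0 k.
  have [->|ki] := eqVneq k i; first by rewrite cei mulr_gt0.
  rewrite cek // eE (negbTE ki) add0r !mxE; have := ler_norm (- a); rewrite normrN.
  have [kj|kj] := eqVneq k j; last by rewrite !mul0r mulr0 !addr0.
  have -> : (i == j) = false by rewrite -kj eq_sym (negbTE ki).
  by rewrite !mul1r mul0r addr0 mul1r; lra.
have ce k : k != i -> c 0 i * e 0 k < c 0 k * e 0 i.
  move=> ki; rewrite cei cek // mulrDl -subr_gt0.
  by rewrite (_ : _ - _ = c0 0 k * e 0 i) ?mulr_gt0 //; ring.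
apply: homologous_trans (hg c c_gt0).
have -> : - (c0 *m (E *m g)) :: row_list (E *m g) =
    - (c *m g) :: set_nth 0 (row_list g) i (e *m g).
  rewrite mulmxA set_nth_row_list; congr (_ :: row_list _).
  apply/row_matrixP => k; rewrite rowK; case: eqP => [->|/eqP ki].
    by rewrite /e row_mul.
  by apply/rowP => y; rewrite mxE elem_mx_mulE (negbTE ki) addr0 mxE.
exact: rad_replace_row.
Qed.

Lemma fglift_signed (K K' : choiceType) (f : K -> {freeg K'}) (n : nat)
    (F : 'I_n -> K) :
  fglift f (\sum_(i < n) (-1) ^+ i *: << F i >>) = \sum_(i < n) (-1) ^+ i *: f (F i).
Proof.
have fB : {morph fglift f : x y / x - y} by exact: lift_is_additive.
have f0 : fglift f 0 = 0 by rewrite -(subrr 0) fB subrr.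
have fN x : fglift f (- x) = - fglift f x by rewrite -[- x]sub0r fB f0 sub0r.
have fD x y : fglift f (x + y) = fglift f x + fglift f y.
  by rewrite -[y in LHS]opprK fB fN opprK.
rewrite (big_morph _ fD f0); apply: eq_bigr => i _.
have fU : fglift f << F i >> = f (F i) by rewrite liftU scale1r.
by rewrite -signr_odd; case: odd; rewrite ?expr1 ?expr0 ?scaleN1r ?scale1r ?fN fU.
Qed.

Lemma push_boundary_affine l : size l = p.+2 ->
  push (@radial R p.+1) (boundary << @affine_simplex R p.+1 p.+1 (nth 0 l) >>) =
  altdel rad l.
Proof.
move=> sl; rewrite /boundary liftU scale1r /push fglift_signed.
rewrite altdelE sl; apply: eq_bigr => i _; rewrite -scaler_int intz.
congr (_ *: << _ >>); apply: eq_clip => t st /=.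
rewrite clipE //= /affine_simplex !clipE //; last exact: face_map_simplex.
congr radial; rewrite -/(barycenter (nth 0 l) (face_map i t)) barycenter_face.
by apply: eq_bigr => j _; rewrite nth_del ?sl.
Qed.

(** The vertices [corner] are the rows of the identity matrix preceded by minus their sum. *)
Lemma sphere_classE :
  sphere_class R p.+1 = altdel rad (- (const_mx 1 *m 1%:M) :: row_list 1%:M).
Proof.
rewrite -push_boundary_affine /= ?size_row_list //.
congr (push _ (boundary << _ >>)); apply: eq_clip => t st.
apply: eq_bigr => i _; congr (_ *: _); case: (unliftP ord0 i) => [j ->|->].
  by rewrite lift0 /= nth_row_list; apply/rowP => k; rewrite !mxE eq_sym.
by rewrite /= mulmx1; apply/rowP => k; rewrite !mxE.
Qed.

Lemma det_elem_mx_diag (i : 'I_p.+1) a g :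
  \det (elem_mx i i a *m g) = (1 + a) * \det g.
Proof.
rewrite (@determinant_multilinear _ _ _ g g i 1 a) ?mulrDl //.
- by apply/rowP => y; rewrite [LHS]mxE elem_mx_mulE eqxx !mxE mul1r.
- apply/matrixP => x y; rewrite [RHS]mxE elem_mx_mulE !mxE.
  by rewrite eq_sym (negbTE (neq_lift _ _)) addr0.
- apply/matrixP => x y; rewrite [RHS]mxE elem_mx_mulE !mxE.
  by rewrite eq_sym (negbTE (neq_lift _ _)) addr0.
Qed.

(** Induction along a product of elementary matrices, starting from the identity matrix, whose
    simplex defines [sphere_class]; the determinant stays positive at each stage. *)
Lemma degree_one_det g : 0 < \det g -> has_degree_one g.
Proof.
move=> dg; have gg := elem_gen_det dg; elim: gg dg => [_|i j a h hij gh IH dg].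
  move=> c c0; rewrite sphere_classE; apply: rad_replace_apex => //.
    by rewrite det1 oner_eq0.
  by move=> k; rewrite mxE ltr01.
have dE : \det (elem_mx i j a *m h) = (if i == j then 1 + a else 1) * \det h.
  case: eqP hij => [<- /= ha|/eqP ij _]; last by rewrite det_elem_mx_mul // mul1r.
  by rewrite det_elem_mx_diag.
have dh : 0 < \det h.
  move: dg; rewrite dE; case: eqP hij => [_ /= ha|_ _]; last by rewrite mul1r.
  by rewrite pmulr_rgt0 //; lra.
apply: has_degree_one_elem => //; first by rewrite gt_eqF.
  by rewrite gt_eqF.
exact: IH.
Qed.

(* The boundary of the boundary of the degenerate simplex [a, b, a, ..] vanishes. *)
Lemma rad_swap (a b : V) l : size l = p ->
  (forall (s : 'I_p.+2 -> R) i, (forall k, 0 <= s k) -> s i = 0 ->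
     \sum_k s k *: nth 0 [:: a, b & l] k = 0 -> forall k, s k = 0) ->
  altdel rad [:: b, a & l] ~~ - altdel rad [:: a, b & l].
Proof.
move=> sl cond; pose i2 : 'I_p.+3 := Ordinal (isT : 2 < p.+3)%N.
have := @altdel2_null R p [:: a, b, a & l] (fun i => (i == ord0) || (i == i2)).
rewrite /= sl (bigD1 ord0) ?eqxx //= (bigD1 i2) //= big1 => [|i]; last by do 2!case: eqP.
rewrite drop0 expr0 mulr1z addr0 sqrrN expr1n mulr1z => /(_ erefl) H.
suff /homologousB/(_ (homologous_refl _ (altdel rad [:: a, b & l]))) :
  altdel rad [:: b, a & l] + altdel rad [:: a, b & l] ~~ 0 by rewrite addrK sub0r.
apply: H => i w; rewrite negb_or => /andP[i0 ii2] w0 wi sw.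
(* The two copies of [a] are merged and their weights added. *)
have w01 : forall k, (fun k : 'I_p.+2 =>
    if k == ord0 then w ord0 + w i2 else w (lift i2 k)) k = 0.
  case: (unliftP i2 i) ii2 => [i' ei|-> /eqP//] _.
  apply: (cond _ i') => [k||].
  - by case: eqP => _; rewrite ?addr_ge0.
  - rewrite -ei wi; case: eqP => // i'0; move: i0; rewrite ei i'0.
    by rewrite (_ : lift i2 ord0 = ord0) ?eqxx //; exact: val_inj.
  move: sw; rewrite (bigD1_ord i2) //= => sw; rewrite -[RHS]sw.
  rewrite big_ord_recl [X in _ = _ + X]big_ord_recl /= scalerDl.
  rewrite (_ : lift i2 ord0 = ord0) /=; last exact: val_inj.
  rewrite addrA [w i2 *: _ + _]addrC; congr (_ + _); apply: eq_bigr => k _.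
  congr (_ *: _); case: k => -[|k] /= hk //.
have /eqP := w01 ord0; rewrite /= paddr_eq0 // => /andP[/eqP w00 /eqP w2].
move=> h; case: (unliftP i2 h) => [h' ->|->] //.
have := w01 h'; case: eqP => // -> _.
by rewrite (_ : lift i2 ord0 = ord0) //; exact: val_inj.
Qed.

Lemma cone_weights g (c : V) (s : 'I_p.+2 -> R) : \det g != 0 ->
  \sum_k s k *: nth 0 (- (c *m g) :: row_list g) k = 0 ->
  forall k, s (lift ord0 k) = s ord0 * c 0 k.
Proof.
move=> dg; rewrite sum_cone -mulNmx scalemxAl -mulmxDl.
move=> /(mulmx_unit_eq0 dg) /rowP e k.
by have := e k; rewrite !mxE => ej; lra.
Qed.

(** Exchanging the apex with row 0 of [g] changes the sign of the chain. The apex becomes a row of a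
    matrix [g'] of positive determinant, for which row 0 of [g] is an admissible apex. *)
Lemma degree_cone_neg g (c : V) : \det g < 0 -> (forall k, 0 < c 0 k) ->
  altdel rad (- (c *m g) :: row_list g) ~~ - sphere_class R p.+1.
Proof.
move=> dg c0; have dg0 : \det g != 0 by rewrite lt_eqF.
pose x := - (c *m g).
pose g' : 'M[R]_p.+1 := \matrix_k if k == ord0 then x else row k g.
have eg : row_list g = row ord0 g :: [seq row (lift ord0 i) g | i <- enum 'I_p].
  by rewrite /row_list enum_ordSl /= -map_comp.
have eg' : row_list g' = x :: [seq row (lift ord0 i) g | i <- enum 'I_p].
  rewrite /row_list enum_ordSl /= -map_comp rowK eqxx; congr (_ :: _).
  by apply: eq_map => i /=; rewrite rowK.
(* These coefficients solve [x = - (c *m g)] for row 0 of [g]. *)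
pose c' : V := \row_k if k == ord0 then (c 0 ord0)^-1 else c 0 k / c 0 ord0.
have c'0 k : 0 < c' 0 k.
  by rewrite mxE; case: eqP => _; rewrite ?invr_gt0 ?divr_gt0.
have g0 : row ord0 g = - (c' *m g').
  have: c 0 ord0 *: row ord0 g = - (c 0 ord0 *: (c' *m g')).
    rewrite !mulmx_sum_row !big_ord_recl /= scalerDr.
    rewrite !rowK !mxE eqxx scalerA divff ?gt_eqF // scale1r opprD.
    rewrite /x mulmx_sum_row big_ord_recl opprK.
    rewrite scaler_sumr -addrA -[LHS]addr0; congr (_ + _).
    rewrite -sumrB big1 // => i _.
    by rewrite !rowK !mxE /= scalerA mulrC divfK ?gt_eqF // subrr.
  by rewrite -scalerN => /scalerI; apply; rewrite gt_eqF.
have dg' : 0 < \det g'.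
  have -> : \det g' = - c 0 ord0 * \det g.
    (* Row 0 of [h] is a combination of its other rows, so [h] is singular and only the multiple of
       row 0 of [g] contributes to the determinant. *)
    pose h : 'M[R]_p.+1 :=
      \matrix_k if k == ord0 then x + c 0 ord0 *: row ord0 g else row k g.
    rewrite (@determinant_multilinear _ _ g' g h ord0 (- c 0 ord0) 1).
    - rewrite mul1r; suff -> : \det h = 0 by rewrite addr0.
      have hk : row ord0 h = \sum_(i < p) - c 0 (lift ord0 i) *: row (lift ord0 i) h.
        rewrite rowK eqxx /x mulmx_sum_row big_ord_recl opprD addrAC addNr add0r.
        by rewrite -sumrN; apply: eq_bigr => i _; rewrite rowK /= scaleNr.
      have sg : (\row_k (if k == ord0 then 1 else c 0 k)) *m h = 0.
        rewrite mulmx_sum_row big_ord_recl [X in X *: _ + _]mxE eqxx scale1r hk.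
        rewrite -big_split big1 // => i _.
        by rewrite /= [X in _ + X *: _]mxE /= scaleNr addNr.
      apply/eqP; apply/negPn/negP => dh; have := mulmx_unit_eq0 dh sg.
      by move/rowP/(_ ord0); rewrite !mxE eqxx => /eqP; rewrite oner_eq0.
    - by rewrite !rowK eqxx scale1r scaleNr addrC addrK.
    - by apply/matrixP => i j; rewrite !mxE.
    - by apply/matrixP => i j; rewrite !mxE.
  by rewrite mulNr oppr_gt0 pmulr_rlt0.
rewrite -/x eg; set t := [seq _ | _ <- _].
have := degree_one_det dg' c'0; rewrite -g0 eg' -/t => /homologousN.
move/(homologous_trans _); apply; rewrite -[X in X ~~ _]opprK; apply: homologousN.
apply: homologous_sym; apply: rad_swap; first by rewrite size_map size_enum_ord.
move=> s i s0 si; rewrite /t -eg /x => /(cone_weights dg0) es.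
have s00 : s ord0 = 0.
  case: (unliftP ord0 i) si => [j ->|-> //]; rewrite es => /eqP.
  by rewrite mulf_eq0 (gt_eqF (c0 _)) orbF => /eqP.
by move=> k; case: (unliftP ord0 k) => [j ->|->] //; rewrite es s00 mul0r.
Qed.

(** In a vanishing combination with nonnegative weights, row [k] has the weight of the apex times
    [c 0 k]. Hence the apex has weight 0, and then so do all rows. *)
Lemma cone_null g (c : V) k : \det g != 0 -> c 0 k < 0 ->
  altdel rad (- (c *m g) :: row_list g) ~~ 0.
Proof.
move=> dg ck; apply: altdel_rad_null => [|t [t0 t1]].
  by rewrite /= size_row_list.
apply/eqP => /(cone_weights dg) e.
have t00 : t 0 ord0 = 0.
  have := e k => ek; have := t0 ord0; rewrite le_eqVlt => /orP[/eqP-> //|tp].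
  by have := t0 (lift ord0 k); rewrite ek leNgt pmulr_rlt0 // ck.
move/eqP: t1; rewrite big1 ?(eq_sym 0) ?oner_eq0 // => j _.
by case: (unliftP ord0 j) => [i ->|->] //; rewrite e t00 mul0r.
Qed.

Lemma degree_cone g (c : V) : \det g != 0 -> (forall k, 0 < c 0 k) ->
  altdel rad (- (c *m g) :: row_list g) ~~ sphere_class R p.+1 *~ sgz (\det g).
Proof.
move=> dg c0; case: (ltrgt0P (\det g)) dg => // dg _.
- by rewrite gtr0_sgz // mulr1z; exact: degree_one_det.
- by rewrite ltr0_sgz // mulrN1z; exact: degree_cone_neg.
Qed.

End ConeDegree.

(** * The winding cycle *)

Section PairLists.

Lemma mem_pairedP r len a I : I \in paired r len a <->
  exists j, [/\ I = pairs j, size j = r, sorted ltn I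
    & all (fun i => a <= i < a + len)%N I].
Proof.
split.
  elim/ltn_ind: len r a I => -[|len] IH [|r] a I.
  - by rewrite paired0 inE => /eqP ->; exists [::].
  - by rewrite in_nil.
  - by rewrite paired0 inE => /eqP ->; exists [::].
  case: len IH => [|len] IH; first by rewrite in_nil.
  rewrite pairedSS mem_cat.
  move=> /orP[/mapP[J /IH [//|j [-> sj sJ aJ]] ->]|/IH[//|j [-> sj sJ aJ]]].
    exists (a :: j); split => //=; first by rewrite sj.
      rewrite ltnSn /= path_sortedE; last exact: ltn_trans.
      by rewrite sJ andbT; apply: sub_all aJ => i /andP[].
    by apply/and3P; split; try lia; apply: sub_all aJ => i /=; lia.
  by exists j; split => //; apply: sub_all aJ => i /=; lia.
case=> j []; elim/ltn_ind: len r a I j => len IH r a I [|j0 j] -> <-.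
  by rewrite paired0.
move=> /= /andP[_ sI] /and3P[aj0 aj1 aI].
case: len IH aj0 aj1 aI => [|[|len]] IH aj0 aj1 aI; [lia|lia|].
have sI' : sorted ltn (pairs j) by apply: path_sorted sI.
have gI : all (ltn j0.+1) (pairs j) by apply: order_path_min sI; exact: ltn_trans.
rewrite pairedSS mem_cat; have [j0a|j0a] := eqVneq j0 a.
  rewrite j0a; apply/orP; left; apply: map_f; apply: IH => //.
  apply/allP => i hi; have /allP/(_ _ hi) := gI; have /allP/(_ _ hi) := aI.
  by rewrite /= j0a; lia.
apply/orP; right; apply: (IH len.+1 _ (size j).+1 _ _ (j0 :: j)) => //=.
  by rewrite ltnSn.
apply/and3P; split; try lia.
apply/allP => i hi; have /allP/(_ _ hi) := gI; have /allP/(_ _ hi) := aI.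
by rewrite /=; lia.
Qed.

Lemma uniq_paired r len a : uniq (paired r len a).
Proof.
elim/ltn_ind: len r a => -[|[|len]] IH [|r] a; rewrite ?paired0 //.
rewrite pairedSS cat_uniq !IH // andbT map_inj_uniq ?IH //=; last by move=> ? ? [].
apply/hasPn => I /mem_pairedP[[|j0 j] [-> //= _ _ /andP[aj _]]].
apply/mapP => -[J _ [e _]]; move: aj; rewrite e; lia.
Qed.

Lemma pairs_inj : injective pairs.
Proof.
by elim=> [|a s IH] [|b t] //= [-> _ /IH ->].
Qed.

(** Lets sums over the enumeration used in the statement be computed by the recursion of
    [paired]. *)
Lemma perm_pair_lists r a b len : b.+1 = (a + len)%N ->
  perm_eq (pair_lists r a b) (paired r len a).
Proof.
move=> hb; apply: uniq_perm.
- apply: filter_uniq; rewrite map_inj_uniq ?enum_uniq // => s t /pairs_inj.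
  by move/(inj_map val_inj)/val_inj.
- exact: uniq_paired.
move=> I; apply/idP/idP => [|/mem_pairedP[j [Ij sj sI aI]]].
  rewrite mem_filter => /andP[/andP[sI aI] /mapP[t _ It]].
  apply/mem_pairedP; exists [seq val i | i <- tval t]; split => //.
    by rewrite size_map size_tuple.
  by apply: sub_all aI => i; lia.
rewrite mem_filter sI /=; apply/andP; split.
  by apply: sub_all aI => i; lia.
have szt : size [seq (inord i : 'I_b.+1) | i <- j] == r by rewrite size_map sj.
apply/mapP; exists (Tuple szt); rewrite ?mem_enum //= -map_comp Ij.
congr pairs; apply/esym/map_id_in => i ij /=; rewrite inordK //.
have : i \in I.
  rewrite Ij; apply/flattenP; exists [:: i; i.+1]; last by rewrite inE eqxx.
  exact: (map_f (fun i => [:: i; i.+1])).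
by move/(allP aI); lia.
Qed.

Lemma size_pairs j : size (pairs j) = (size j).*2.
Proof. by elim: j => //= a j ->. Qed.

Lemma size_paired r len a I : I \in paired r len a -> size I = r.*2.
Proof. by move=> /mem_pairedP[j [-> <- _ _]]; rewrite size_pairs. Qed.

End PairLists.

(** * Coning and filling the winding cycle *)

Lemma altdel_map (T T' : Type) (V : zmodType) (h : T' -> T) (f : seq T -> V) s :
  altdel f (map h s) = altdel (fun s' => f (map h s')) s.
Proof. by elim: s f => //= a s IH f; rewrite IH. Qed.

Section WindingCycle.
Variables (R : realType) (n k p : nat).
Variables (Z : 'M[R]_(n, k + p.+1)).
Implicit Types (Y : 'M[R]_(k, k + p.+1)) (Q : 'M[R]_(k + p.+1, p.+1)).
Notation "c ~~ c'" := (homologous (@sphere R p.+1) c c') (at level 70).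
Notation rad := (@rad_chain R p).

Definition zpts Q (I : seq nat) := [seq zrow Z i *m Q | i <- I].
Definition zmx (I : seq nat) : 'M[R]_(p.+1, k + p.+1) :=
  \matrix_a zrow Z (nth 0%N I a).

Lemma zptsE Q I : size I = p.+1 -> zpts Q I = row_list (zmx I *m Q).
Proof.
move=> sI; apply: (@eq_from_nth _ 0); first by rewrite size_map size_row_list.
move=> i; rewrite size_map sI => ip; rewrite (nth_map 0%N) ?sI //.
by rewrite -[i]/(val (Ordinal ip)) nth_row_list row_mul rowK.
Qed.

Lemma push_zsimplex Q I : size I = p.+1 ->
  push (@radial R p.+1) << zsimplex Z Q I >> = rad (zpts Q I).
Proof.
move=> sI; rewrite /push liftU scale1r; congr << _ >>.
apply: eq_clip => t st /=; rewrite /zsimplex /affine_simplex !clipE //.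
by congr radial; apply: eq_bigr => i _; rewrite (nth_map 0%N) ?sI.
Qed.

Lemma push_winding_cycle Q r : p.+1 = r.+1.*2 -> (1 < n)%N ->
  push (@radial R p.+1) (winding_cycle Z Q) =
  \sum_(I <- paired r.+1 n 1) rad (zpts Q I)
  - \sum_(J <- paired r n.-2 2) rad (zpts Q (1%N :: rcons J n)).
Proof.
move=> pr n2.
have pB : {morph push (p := p) (@radial R p.+1) : x y / x - y} by exact: lift_is_additive.
have p0 : push (p := p) (@radial R p.+1) 0 = 0.
  by have := pB 0 0; rewrite !subrr.
have pN : {morph push (p := p) (@radial R p.+1) : x / - x}.
  by move=> x; have := pB 0 x; rewrite !sub0r p0 sub0r.
have pD : {morph push (p := p) (@radial R p.+1) : x y / x + y}.
  by move=> x y; have := pB x (- y); rewrite pN !opprK.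
have ph : p.+1./2 = r.+1 by rewrite pr doubleK.
rewrite /winding_cycle pB ph.
rewrite !(big_morph _ pD p0); congr (_ - _).
  have P1 : n.+1 = (1 + n)%N by lia.
  rewrite (perm_big _ (perm_pair_lists r.+1 P1)) !big_seq.
  by apply: eq_bigr => I /size_paired sI; rewrite push_zsimplex // sI pr.
have P2 : n.-1.+1 = (2 + n.-2)%N by lia.
rewrite (perm_big _ (perm_pair_lists r P2)) !big_seq.
apply: eq_bigr => I /size_paired sI; rewrite push_zsimplex //.
by rewrite /= size_rcons sI pr doubleS.
Qed.

(** ∂[x, I] = [I] - [x, ∂I], and the second terms cancel in the sum because the chain is a cycle. *)
Lemma push_winding_cycle_cone Q r (x : 'rV[R]_p.+1) :
  p.+1 = r.+1.*2 -> (1 < n)%N ->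
  push (@radial R p.+1) (winding_cycle Z Q) =
  \sum_(I <- paired r.+1 n 1) altdel rad (x :: zpts Q I)
  - \sum_(J <- paired r n.-2 2) altdel rad (x :: zpts Q (1%N :: rcons J n)).
Proof.
move=> pr n2; rewrite (push_winding_cycle _ pr n2).
have n2E : n = n.-2.+2 by lia.
have := altdel_paired_boundary r n.-2 1 (fun s => rad (x :: zpts Q s)).
rewrite -n2E addSnnS add0n -n2E => /eqP; rewrite subr_eq0 => /eqP e.
have E s : altdel rad (x :: zpts Q s) =
    rad (zpts Q s) - altdel (fun s' => rad (x :: zpts Q s')) s.
  by rewrite /= /zpts altdel_map.
rewrite (eq_bigr _ (fun I _ => E I)) [X in _ = _ - X](eq_bigr _ (fun J _ => E _)).
by rewrite sumrB [X in _ = _ - X]sumrB e opprB addrA subrK.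
Qed.

Lemma push_winding_cycle_fill Q r : p.+1 = r.+1.*2 -> (1 < n)%N ->
  push (@radial R p.+1) (winding_cycle Z Q) =
  \sum_(I <- paired r.+1 n.-1 2) altdel rad (zpts Q (1%N :: I)).
Proof.
move=> pr n2; rewrite (push_winding_cycle _ pr n2).
have n2E : n = n.-2.+2 by lia.
have := big_paired_boundary r n.-2 1 (fun s => rad (zpts Q s)).
rewrite -n2E addSnnS add0n -n2E -[n.-2.+1]/(n.-2.+2.-1) -n2E => ->.
by apply: eq_bigr => I _; rewrite /zpts altdel_map.
Qed.

End WindingCycle.

(** * Twistor signs and the degree of a single cone *)

Section ConeSigns.
Variables (R : realType) (k p : nat).
Implicit Types (Y : 'M[R]_(k, k + p.+1)) (Q : 'M[R]_(k + p.+1, p.+1)).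
Implicit Types (F : 'M[R]_(p.+1, k + p.+1)) (X : 'rV[R]_(k + p.+1)).
Notation "c ~~ c'" := (homologous (@sphere R p.+1) c c') (at level 70).
Notation rad := (@rad_chain R p).

Definition set_row m n (i : 'I_m) (x : 'rV[R]_n) (g : 'M[R]_(m, n)) : 'M[R]_(m, n) :=
  \matrix_h if h == i then x else row h g.

Lemma set_row_mul m n q (i : 'I_m) (x : 'rV[R]_n) (g : 'M[R]_(m, n)) (B : 'M[R]_(n, q)) :
  set_row i x g *m B = set_row i (x *m B) (g *m B).
Proof.
by apply/row_matrixP => h; rewrite row_mul !rowK; case: eqP => // _; rewrite row_mul.
Qed.

Lemma cofactor_set_row m (i : 'I_m) (x : 'rV[R]_m) (g : 'M[R]_m) j :
  cofactor (set_row i x g) i j = cofactor g i j.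
Proof.
rewrite /cofactor; congr (_ * \det _); apply/matrixP => a b.
rewrite 2![LHS]mxE 2![RHS]mxE [LHS]mxE.
by rewrite eq_sym (negbTE (neq_lift _ _)) mxE.
Qed.

(** Cramer's rule without division: the cofactors along row [i] do not involve that row. *)
Lemma det_set_row m (i : 'I_m) (y : 'rV[R]_m) (g : 'M[R]_m) :
  \det (set_row i (y *m g) g) = y 0 i * \det g.
Proof.
rewrite (expand_det_row _ i).
have -> : \sum_j set_row i (y *m g) g i j * cofactor (set_row i (y *m g) g) i j
   = (y *m g *m \adj g) 0 i.
  rewrite [RHS]mxE; apply: eq_bigr => j _.
  rewrite [\adj g _ _]mxE cofactor_set_row.
  by congr (_ * _); rewrite [LHS]mxE eqxx.
by rewrite -mulmxA mul_mx_adj mul_mx_scalar mxE mulrC.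
Qed.

Lemma det_set_rowN m (i : 'I_m) (g : 'M[R]_m) :
  \det (set_row i (- row i g) g) = - \det g.
Proof. by rewrite rowE -mulNmx det_set_row !mxE !eqxx mulN1r. Qed.

Lemma col_mx_set_row Y F (i : 'I_p.+1) X :
  col_mx Y (set_row i X F) = set_row (rshift k i) X (col_mx Y F).
Proof.
apply/row_matrixP => x; rewrite rowK; case: (split_ordP x) => j ->.
  by rewrite !rowKu eq_lrshift.
by rewrite !rowKd rowK eq_rshift.
Qed.

(** The twistor coordinate for arbitrary rows, so that an auxiliary vector can take the place of a
    row of [Z]. *)
Definition tw Y F := \det (col_mx Y F).

Lemma oriented_det_gt0 Y Q F : oriented_quotient Y Q ->
  (0 < \det (F *m Q)) = (0 < tw Y F).
Proof. by case. Qed.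

(** The orientation condition only compares positivity; negating one row of [F] transfers it to
    negative determinants. *)
Lemma oriented_det_lt0 Y Q F : oriented_quotient Y Q ->
  (\det (F *m Q) < 0) = (tw Y F < 0).
Proof.
move=> oQ; have := oriented_det_gt0 (set_row ord0 (- row ord0 F) F) oQ.
rewrite set_row_mul mulNmx -row_mul det_set_rowN oppr_gt0 => ->.
by rewrite /tw col_mx_set_row -(rowKd _ Y F) det_set_rowN oppr_gt0.
Qed.

Lemma sgz_oriented_det Y Q F : oriented_quotient Y Q ->
  sgz (\det (F *m Q)) = sgz (tw Y F).
Proof.
move=> oQ; have := oriented_det_gt0 F oQ; have := oriented_det_lt0 F oQ.
by do 2!case: sgzP.
Qed.

(* The origin is in the interior of the simplex spanned by X and the rows of F
   iff, by Cramer's rule, replacing any row of F by X changes the sign of the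
   twistor coordinate. *)
Definition cone_degree Y F X : int :=
  if [forall i, tw Y (set_row i X F) * tw Y F < 0] then sgz (tw Y F) else 0.

Lemma cone_coord Y Q F X : oriented_quotient Y Q -> tw Y F != 0 ->
  exists c : 'rV[R]_p.+1, [/\ \det (F *m Q) != 0, X *m Q = - (c *m (F *m Q))
    & forall i, sgz (c 0 i) = - (sgz (tw Y (set_row i X F)) * sgz (tw Y F))].
Proof.
move=> oQ tF; have dg : \det (F *m Q) != 0.
  by rewrite -sgz_eq0 (sgz_oriented_det _ oQ) sgz_eq0.
pose c := - (X *m Q *m invmx (F *m Q)).
have ug : F *m Q \in unitmx by rewrite unitmxE unitfE.
exists c; split => // [|i]; first by rewrite mulNmx opprK mulmxKV.
rewrite -!(sgz_oriented_det _ oQ) set_row_mul.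
have -> : X *m Q = - c *m (F *m Q) by rewrite opprK mulmxKV.
rewrite det_set_row sgzM -mulrA -sgzM -expr2.
by rewrite (gtr0_sgz (_ : 0 < _ ^+ 2)) ?exprn_even_gt0 // mulr1 mxE sgzN opprK.
Qed.

(** Since no coordinate vanishes, either all are positive and the degree is the sign of the
    determinant, or one is negative and the origin lies outside. *)
Lemma cone_eval Y Q F X : oriented_quotient Y Q -> tw Y F != 0 ->
  (forall i, tw Y (set_row i X F) != 0) ->
  altdel rad (X *m Q :: row_list (F *m Q)) ~~
  sphere_class R p.+1 *~ cone_degree Y F X.
Proof.
move=> oQ tF tX; have [c [dg -> sc]] := cone_coord X oQ tF.
rewrite /cone_degree; case: forallP => [neg|/forallP].
  rewrite -(sgz_oriented_det _ oQ); apply: degree_cone => // i.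
  by rewrite -sgz_gt0 sc -sgzM oppr_gt0 sgz_lt0.
rewrite negb_forall => /existsP[i]; rewrite -leNgt le_eqVlt eq_sym.
rewrite mulf_eq0 (negbTE tF) orbF (negbTE (tX i)) /= => pos.
rewrite mulr0z; apply: (@cone_null _ _ _ _ i) => //.
by rewrite -sgz_lt0 sc -sgzM oppr_lt0 sgz_gt0.
Qed.

Lemma cone_eval_null Y Q F X i : oriented_quotient Y Q -> tw Y F != 0 ->
  0 < tw Y (set_row i X F) * tw Y F ->
  altdel rad (X *m Q :: row_list (F *m Q)) ~~ 0.
Proof.
move=> oQ tF pos; have [c [dg -> sc]] := cone_coord X oQ tF.
apply: (@cone_null _ _ _ _ i) => //.
by rewrite -sgz_lt0 sc -sgzM oppr_lt0 sgz_gt0.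
Qed.

Lemma oriented_quotient_exists Y F : 0 < tw Y F -> exists Q, oriented_quotient Y Q.
Proof.
move=> tF; pose M := col_mx Y F.
(* [Q] reads off the coordinates along [F] in the basis formed by the rows of [Y] and [F]. *)
pose Q : 'M[R]_(k + p.+1, p.+1) := invmx M *m col_mx 0 1%:M.
have uM : M \in unitmx by rewrite unitmxE unitfE gt_eqF.
have : M *m Q = col_mx 0 1%:M by rewrite mulKVmx.
rewrite mul_col_mx => /eq_col_mx[YQ FQ].
have YM : Y *m invmx M = row_mx 1%:M 0.
  have {1}-> : Y = row_mx 1%:M 0 *m M by rewrite mul_row_col mul1mx mul0mx addr0.
  by rewrite mulmxK.
have rY : \rank Y = k.
  apply/eqP; apply/row_freeP; exists (invmx M *m col_mx 1%:M 0).
  by rewrite mulmxA YM mul_row_col mul1mx mulmx0 addr0.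
have rQ : row_full Q by apply/row_fullP; exists F.
exists Q; split => // [|F'].
  have sYK : (Y <= kermx Q)%MS by apply/sub_kermxP.
  rewrite andbC sYK /= -(geq_leqif (mxrank_leqif_sup sYK)) mxrank_ker rY.
  by rewrite (eqP rQ) addnK.
have -> : \det (col_mx Y F') = \det (F' *m Q) * tw Y F.
  rewrite /tw -/M -[X in \det X = _](mulmxKV uM) det_mulmx; congr (_ * _).
  have FM : F' *m invmx M = row_mx (lsubmx (F' *m invmx M)) (F' *m Q).
    rewrite -[LHS]hsubmxK; congr row_mx.
    rewrite /Q mulmxA -[in RHS](hsubmxK (F' *m invmx M)) mul_row_col.
    by rewrite mulmx0 add0r mulmx1.
  by rewrite mul_col_mx YM FM -/(block_mx _ _ _ _) det_lblock det1 mul1r.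
by rewrite pmulr_lgt0.
Qed.

(** The coefficients of the linear form that sends [X] to the twistor coordinate with row [i] of [F]
    replaced by [X]; its kernel is one of the hyperplanes to be avoided. *)
Definition cofactor_col Y F (i : 'I_p.+1) : 'cV[R]_(k + p.+1) :=
  \col_j cofactor (col_mx Y F) (rshift k i) j.

Lemma tw_set_row Y F i X : tw Y (set_row i X F) = (X *m cofactor_col Y F i) 0 0.
Proof.
rewrite /tw col_mx_set_row (expand_det_row _ (rshift k i)) [RHS]mxE.
apply: eq_bigr => j _; rewrite [set_row _ _ _ _ _]mxE eqxx.
by rewrite [cofactor_col _ _ _ _ _]mxE cofactor_set_row.
Qed.

Lemma set_row_id m n (i : 'I_m) (g : 'M[R]_(m, n)) : set_row i (row i g) g = g.
Proof. by apply/row_matrixP => h; rewrite rowK; case: eqP => [->|]. Qed.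

Lemma cofactor_col_neq0 Y F i : tw Y F != 0 -> cofactor_col Y F i != 0.
Proof.
apply: contraNneq => u0.
by rewrite -(set_row_id i F) tw_set_row u0 mulmx0 mxE.
Qed.

End ConeSigns.

(** * Vectors off finitely many hyperplanes *)

Section GenericPoint.
Variable R : realType.

Lemma exists_nonroot (P : {poly R}) : P != 0 -> exists t, P.[t] != 0.
Proof.
move=> P0; apply: contrapT => h.
have rP t : root P t by apply/negPn/negP => /negP nr; apply: h; exists t; apply/negP.
have := @max_poly_roots _ P [seq i%:R | i <- iota 0 (size P)] P0.
rewrite size_map size_iota ltnn; case/(_ _ _)/notF => //.
  by apply/allP => t _; exact: rP.
rewrite map_inj_uniq ?iota_uniq // => i j /eqP; rewrite eqr_nat => /eqP.
by [].
Qed.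

(** On the moment curve each linear form becomes a nonzero polynomial in [t]; a non-root of the
    product of these polynomials gives [X]. *)
Lemma exists_generic_row N (us : seq 'cV[R]_N) : all (fun u => u != 0) us ->
  exists X : 'rV[R]_N, {in us, forall u, (X *m u) 0 0 != 0}.
Proof.
move=> us0; pose P (u : 'cV[R]_N) : {poly R} := \sum_j u j 0 *: 'X^j.
have P0 : \prod_(u <- us) P u != 0.
  rewrite prodf_seq_neq0; apply/allP => u uus /=; apply/eqP => Pu.
  have /eqP := allP us0 _ uus; apply; apply/colP => j; rewrite mxE.
  have := congr1 (fun q : {poly R} => q`_j) Pu; rewrite coef0 coef_sum.
  rewrite (bigD1 j) //= coefZ coefXn eqxx mulr1 big1 ?addr0 // => i ij.
  by rewrite coefZ coefXn eq_sym val_eqE (negbTE ij) mulr0.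
have [t Pt] := exists_nonroot P0; exists (\row_j t ^+ j) => u uus.
move: Pt; rewrite horner_prod prodf_seq_neq0 => /allP/(_ _ uus) /=.
rewrite horner_sum mxE; congr (_ != 0); apply: eq_bigr => j _.
by rewrite mxE hornerZ hornerXn mulrC.
Qed.

End GenericPoint.

(** * Homotopy invariance *)

Section Homotopy.
Variables (R : realType) (n k r p : nat).
Hypotheses (pr : p.+1 = r.+1.*2) (pn : (p.+1 <= n)%N).
Variable Z : 'M[R]_(n, k + p.+1).
Implicit Types (Y : 'M[R]_(k, k + p.+1)) (Q : 'M[R]_(k + p.+1, p.+1)).
Implicit Types (F : 'M[R]_(p.+1, k + p.+1)) (X : 'rV[R]_(k + p.+1)).
Notation "c ~~ c'" := (homologous (@sphere R p.+1) c c') (at level 70).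
Notation rad := (@rad_chain R p).

Definition coarse_facets : seq 'M[R]_(p.+1, k + p.+1) :=
  [seq zmx Z J | J <- paired r.+1 n 1]
  ++ [seq zmx Z (1%N :: rcons J n) | J <- paired r n.-2 2].

Definition off_coarse Y := {in coarse_facets, forall F, tw Y F != 0}.

Definition generic Y X :=
  {in coarse_facets, forall F, forall i, tw Y (set_row i X F) != 0}.

(** The signed number of facets met by the ray from the origin in the direction opposite to [X]. *)
Definition ray_count Y X : int :=
  \sum_(I <- paired r.+1 n 1) cone_degree Y (zmx Z I) X
  - \sum_(J <- paired r n.-2 2) cone_degree Y (zmx Z (1%N :: rcons J n)) X.

Lemma n_gt1 : (1 < n)%N.
Proof. lia. Qed.

Lemma homologous_big (I : eqType) (s : seq I)
    (f g : I -> {freeg ('rV[R]_p.+1 -> 'rV[R]_p.+1)}) :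
  {in s, forall i, f i ~~ g i} -> \sum_(i <- s) f i ~~ \sum_(i <- s) g i.
Proof.
by move=> fg; rewrite !big_seq; apply: homologous_sum => i; exact: fg.
Qed.

Lemma winding_ray_count Y Q X : oriented_quotient Y Q -> off_coarse Y -> generic Y X ->
  push (@radial R p.+1) (winding_cycle Z Q) ~~ sphere_class R p.+1 *~ ray_count Y X.
Proof.
move=> oQ oY gX; rewrite (push_winding_cycle_cone Z Q (X *m Q) pr n_gt1).
rewrite /ray_count mulrzBr !mulrz_sumr; apply: homologousB; apply: homologous_big => I hI.
  have hF : zmx Z I \in coarse_facets by rewrite mem_cat map_f.
  rewrite zptsE ?(size_paired hI) ?pr //; apply: cone_eval => //; first exact: oY.
  exact: gX.
have hF : zmx Z (1%N :: rcons I n) \in coarse_facets.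
  rewrite mem_cat; apply/orP; right.
  exact: (map_f (fun J => zmx Z (1%N :: rcons J n))).
rewrite zptsE; last by rewrite /= size_rcons (size_paired hI) pr doubleS.
by apply: cone_eval => //; [exact: oY|exact: gX].
Qed.

Lemma exists_generic Y : off_coarse Y -> exists X, generic Y X.
Proof.
move=> oY.
pose us := [seq cofactor_col Y F i | F <- coarse_facets, i <- enum 'I_p.+1].
have us0 : all (fun u => u != 0) us.
  by apply/allP => u /allpairsP[[F i] [/= hF _ ->]]; apply: cofactor_col_neq0; exact: oY.
have [X hX] := exists_generic_row us0; exists X => F hF i; rewrite tw_set_row; apply: hX.
by apply/allpairsP; exists (F, i); split; rewrite //= mem_enum.
Qed.

Lemma near_seq (I : eqType) (s : seq I) (t0 : R) (P : I -> R -> Prop) :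
  {in s, forall i, \forall t \near t0, P i t} ->
  \forall t \near t0, {in s, forall i, P i t}.
Proof.
elim: s => [|i s IH] h; first by apply: (@filterE _ (nbhs t0)) => t i; rewrite in_nil.
have h1 : \forall t \near t0, P i t by apply: h; rewrite mem_head.
have /IH h2 : {in s, forall j, \forall t \near t0, P j t}.
  by move=> j js; apply: h; rewrite in_cons js orbT.
near=> t => j; rewrite in_cons => /orP[/eqP->|].
  by near: t.
by move: j; near: t.
Unshelve. all: by end_near. Qed.

Lemma near_sgz (f : R -> R) t0 : continuous f -> f t0 != 0 ->
  \forall t \near t0, sgz (f t) = sgz (f t0).
Proof.
move=> cf f0; case: (ltrgt0P (f t0)) f0 => // h _.
  have H : \forall t \near t0, 0 < f t by apply: (cvgr_gt _ (cf t0)).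
  by near=> t; rewrite !gtr0_sgz //; near: t.
have H : \forall t \near t0, f t < 0 by apply: (cvgr_lt _ (cf t0)).
by near=> t; rewrite !ltr0_sgz //; near: t.
Unshelve. all: by end_near. Qed.

Variable Yt : R -> 'M[R]_(k, k + p.+1).
Hypothesis cont_tw : forall F, continuous (fun t : R => tw (Yt t) F).
Hypothesis coarse_t : forall t : R, 0 <= t <= 1 -> off_coarse (Yt t).

(** The vector [X] is fixed generic for [t0]. The ray count depends only on the signs of finitely
    many twistor coordinates, nonzero at [t0] and continuous in [t], so it is constant near [t0]. *)
Lemma locally_constant_winding (t0 : R) : 0 <= t0 <= 1 -> exists N : int,
  \forall t \near t0, 0 <= t <= 1 -> forall Q, oriented_quotient (Yt t) Q ->
    push (@radial R p.+1) (winding_cycle Z Q) ~~ sphere_class R p.+1 *~ N.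
Proof.
move=> t01; have [X gX] := exists_generic (coarse_t t01).
exists (ray_count (Yt t0) X).
pose Fs := coarse_facets ++ [seq set_row i X F | F <- coarse_facets, i <- enum 'I_p.+1].
have Fs0 : {in Fs, forall F, tw (Yt t0) F != 0}.
  move=> F; rewrite mem_cat => /orP[|/allpairsP[[G i] [/= hG _ ->]]].
    exact: coarse_t.
  exact: gX.
have := @near_seq _ Fs t0 (fun F t => sgz (tw (Yt t) F) = sgz (tw (Yt t0) F)) _.
move=> /(_ (fun F hF => near_sgz (cont_tw (F := F)) (Fs0 F hF))).
apply: filterS => t sg t01' Q oQ.
have sgF F : F \in coarse_facets -> sgz (tw (Yt t) F) = sgz (tw (Yt t0) F).
  by move=> hF; apply: sg; rewrite mem_cat hF.
have sgX F i : F \in coarse_facets ->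
    sgz (tw (Yt t) (set_row i X F)) = sgz (tw (Yt t0) (set_row i X F)).
  move=> hF; apply: sg; rewrite mem_cat; apply/orP; right.
  by apply/allpairsP; exists (F, i); split; rewrite //= mem_enum.
have gXt : generic (Yt t) X.
  by move=> F hF i; rewrite -sgz_eq0 sgX // sgz_eq0; exact: gX.
have cd F : F \in coarse_facets -> cone_degree (Yt t) F X = cone_degree (Yt t0) F X.
  move=> hF; rewrite /cone_degree sgF //; congr (if _ then _ else _).
  apply: eq_forallb => i; rewrite -sgz_lt0 sgzM sgX // sgF // -sgzM sgz_lt0.
  by [].
have <- : ray_count (Yt t) X = ray_count (Yt t0) X.
  rewrite /ray_count; congr (_ - _); rewrite !big_seq; apply: eq_bigr => I hI; apply: cd.
    by rewrite mem_cat map_f.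
  rewrite mem_cat; apply/orP; right.
  exact: (map_f (fun J => zmx Z (1%N :: rcons J n))).
by apply: winding_ray_count => //; exact: coarse_t.
Qed.

Lemma paired_nonempty q len a : (q.*2 <= len)%N -> exists I, I \in paired q len a.
Proof.
elim: q len a => [|q IH] len a; first by exists [::]; rewrite paired0 inE.
case: len => [|[|len]] //; rewrite doubleS !ltnS => h; have [J hJ] := IH len a.+2 h.
by exists [:: a, a.+1 & J]; rewrite pairedSS mem_cat (map_f (fun J => [:: a, a.+1 & J])).
Qed.

(** A nonzero coarse twistor coordinate provides a complement of [Y]; negating one row corrects its
    orientation if necessary. *)
Lemma exists_oriented Y : off_coarse Y -> exists Q, oriented_quotient Y Q.
Proof.
move=> oY; have [|I hI] := @paired_nonempty r.+1 n 1; first by rewrite -pr.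
have : tw Y (zmx Z I) != 0 by apply: oY; rewrite mem_cat map_f.
case: (ltrgt0P (tw Y (zmx Z I))) => // h _; first exact: oriented_quotient_exists h.
pose F := zmx Z I.
apply: (@oriented_quotient_exists _ _ _ _ (set_row ord0 (- row ord0 F) F)).
by rewrite /tw col_mx_set_row -(rowKd _ Y) det_set_rowN oppr_gt0.
Qed.

(* Near each t the cycle is homologous to N times the fundamental class for some
   fixed N, so the set of t where it is homologous to w times this class is open
   and closed; that the class has infinite order is not needed. *)
Lemma winding_homotopy (w : int) :
  has_winding_number Z (Yt 1) w -> has_winding_number Z (Yt 0) w.
Proof.
pose W (t : R) := has_winding_number Z (Yt t) w.
have loc (t0 : R) : 0 <= t0 <= 1 -> \forall t \near t0, 0 <= t <= 1 -> (W t <-> W t0).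
  move=> t01; have [N] := locally_constant_winding t01.
  move=> h; have h0 := nbhs_singleton h t01; move: h.
  apply: filterS => t ht /[dup] /ht{}ht t01'.
  (* As an oriented [Q] exists, [W s] amounts to a relation between multiples of the fundamental
     class that does not involve [s]. *)
  have WN (s : R) : 0 <= s <= 1 -> (forall Q, oriented_quotient (Yt s) Q ->
      push (@radial R p.+1) (winding_cycle Z Q) ~~ sphere_class R p.+1 *~ N) ->
      W s <-> sphere_class R p.+1 *~ N ~~ w *: sphere_class R p.+1.
    move=> s01 hs; split => [Ws|hN Q oQ].
      have [Q oQ] := exists_oriented (coarse_t s01).
      exact: homologous_trans (homologous_sym (hs Q oQ)) (Ws Q oQ).
    exact: homologous_trans (hs Q oQ) hN.
  by rewrite (WN _ t01' ht) (WN _ t01 h0).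
move=> W1; pose A : set R := `[0, 1]%classic.
have AE t : A t <-> 0 <= t <= 1 by rewrite /A /= in_itv.
have BA : A `&` [set t | W t] = A.
  apply: (@segment_connected R 0 1).
    by exists 1; split => //; apply/AE; rewrite ler01 lexx.
    exists (interior [set t | 0 <= t <= 1 -> W t]); first exact: open_interior.
    apply/seteqP; split => t [/AE At Wt]; split; try exact/AE.
      have := loc t At; apply: filterS => s hs s01.
      by apply/(hs s01).
    by have := nbhs_singleton Wt; apply.
  exists (~` interior [set t | 0 <= t <= 1 -> ~ W t]).
    by apply: open_closedC; exact: open_interior.
  apply/seteqP; split => t [/AE At Wt]; split; try exact/AE.
    by move=> /nbhs_singleton /(_ At); apply.
  apply: contrapT => nWt; apply: Wt; have := loc t At; apply: filterS => s hs s01.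
  by move/(hs s01).
have : A 0 by apply/AE; rewrite lexx ler01.
by rewrite -BA => -[].
Qed.

End Homotopy.

(** * Twistor coordinates as combinations of minors *)

Lemma increasing_leq p n (f : 'I_p -> 'I_n) i j : increasing f ->
  (f i < f j)%N = (i < j)%N.
Proof.
move=> incf; case: (ltngtP i j) => [/incf//|/incf h|/val_inj->]; last exact: ltnn.
by rewrite ltnNge ltnW.
Qed.

Lemma increasing_inj p n (f : 'I_p -> 'I_n) : increasing f -> injective f.
Proof.
move=> incf i j fij.
by case: (ltngtP i j) => [/incf|/incf|/val_inj//]; rewrite fij ltnn.
Qed.

Lemma sort_injective p n (f : 'I_p -> 'I_n) : injective f ->
  exists s : 'S_p, increasing (f \o s).
Proof.
move=> injf; pose le (i j : 'I_n) := (i <= j)%N.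
have le_total : total le by move=> i j; exact: leq_total.
have le_trans : transitive le by move=> j i k; exact: leq_trans.
have : perm_eq (sort le (codom f)) [tuple f i | i < p] by rewrite perm_sort /= -codomE.
case/tuple_permP => s es; exists s => i j ij.
have us : uniq (sort le (codom f)) by rewrite sort_uniq; exact/injectiveP.
have ss : sorted le (sort le (codom f)) by exact: sort_sorted.
have sz : size (sort le (codom f)) = p by rewrite size_sort size_codom card_ord.
have nthE (h : 'I_p) : nth (f i) (sort le (codom f)) h = f (s h).
  by rewrite es -tnth_nth !tnth_mktuple.
have := sorted_ltn_nth le_trans (f i) ss; move=> /(_ i j).
rewrite !inE sz !ltn_ord !nthE => /(_ isT isT ij); rewrite /le leq_eqVlt => /orP[|//].
by move=> /eqP/val_inj/injf/perm_inj e; move: ij; rewrite e ltnn.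
Qed.

Section MinorExpansion.
Variables (R : realType) (n k m : nat) (Z : 'M[R]_(n, k + m)).
Hypothesis hZ : positive_rows Z.
Implicit Types (C : 'M[R]_(k, n)) (l : 'I_m -> 'I_n) (f : 'I_(k + m) -> 'I_n).

(* In the Cauchy-Binet expansion over the subsets S of the index set, the
   complement of l in S contributes a minor of C with the sign given by the
   positions l' of l in S; the condition is that this sign does not depend on S. *)
Definition parity_class (eps : bool) l :=
  forall (g : 'I_(k + m) -> 'I_n) (l' : 'I_m -> 'I_(k + m)), increasing g ->
    (forall a, g (l' a) = l a) -> odd (\sum_(a < m) (k + a + l' a)) = eps.

(** Its product with [Z] is the matrix of the twistor coordinate: [C *m Z] on top of the rows [l] of
    [Z]. *)
Definition lift_mx C l : 'M[R]_(k + m, n) := col_mx C (rowsub l 1%:M).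

Definition twistor_term C l f : R :=
  \det (colsub f (lift_mx C l)) * \det (rowsub f Z).

Lemma det_colsub_perm q (M : 'M[R]_(q, n)) (f : 'I_q -> 'I_n) (s : 'S_q) :
  \det (colsub (f \o s) M) = (-1) ^+ s * \det (colsub f M).
Proof.
rewrite mulrC -odd_permV -det_perm -det_mulmx; congr (\det _).
by rewrite -col_permE; apply/matrixP => i j; rewrite !mxE.
Qed.

Lemma twistor_term_perm C l f (s : 'S_(k + m)) :
  twistor_term C l (f \o s) = twistor_term C l f.
Proof.
rewrite /twistor_term det_colsub_perm det_rowsub_perm mulrACA -expr2 sqrr_sign.
by rewrite mul1r.
Qed.

Lemma twistor_term_noninj C l f : ~~ injectiveb f -> twistor_term C l f = 0.
Proof.
case/injectivePn => i [j ij fij]; rewrite /twistor_term.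
rewrite [X in _ * X](determinant_alternate ij) ?mulr0 // => h.
by rewrite !mxE fij.
Qed.

Lemma twistor_term_out C l f a : l a \notin codom f -> twistor_term C l f = 0.
Proof.
move=> la; rewrite /twistor_term (expand_det_row _ (rshift k a)) big1 ?mul0r // => j _.
rewrite mxE col_mxEd !mxE (_ : (l a == f j) = false) ?mul0r //.
by apply: contraNF la => /eqP->; exact: codom_f.
Qed.

(** After sorting [f], Laplace expansion along the unit rows leaves the minor of [C] on the
    complement of [l], with the sign fixed by [parity_class]; [beta] is a maximal minor of [Z].
    Neither [beta] nor [h] depends on [C], so different matrices can be compared term by term. *)
Lemma twistor_term_minor eps l f : increasing l -> parity_class eps l ->
  injective f -> (forall a, l a \in codom f) ->
  exists beta, exists h : 'I_k -> 'I_n,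
    [/\ 0 < beta, increasing h, forall i, h i \in codom f,
      forall i a, h i != l a
      & forall C, (-1) ^+ eps * twistor_term C l f = beta * \det (colsub h C)].
Proof.
move=> incl pl injf lf; have [s incg] := sort_injective injf.
set g := f \o s in incg.
have /fin_all_exists[l' gl] : forall a, exists j, g j = l a.
  move=> a; exists ((s^-1)%g (iinv (lf a))); by rewrite /g /= permKV f_iinv.
have incl' : increasing l'.
  by move=> a b ab; rewrite -(increasing_leq _ _ incg) !gl; exact: incl.
pose L (a : nat) := if insub a is Some a' then nat_of_ord (l' a') else 0%N.
have LE (a : 'I_m) : L a = l' a by rewrite /L valK.
have [||H [Hinc Hlt HL HB]] := @det_unit_rows R k m L.
- move=> a b /andP[ab bm]; have am := ltn_trans ab bm.
  by rewrite -[a]/(val (Ordinal am)) -[b]/(val (Ordinal bm)) !LE; exact: incl'.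
- by move=> a am; rewrite -[a]/(val (Ordinal am)) LE.
pose h (i : 'I_k) := g (Ordinal (Hlt i (ltn_ord i))).
exists (\det (rowsub g Z)), h; split.
- exact: hZ.
- by move=> i j ij; apply: incg => /=; exact: Hinc.
- by move=> i; rewrite /h /g /=; exact: codom_f.
- move=> i a; rewrite -gl (inj_eq (increasing_inj incg)) -val_eqE /= -LE.
  exact: HL.
move=> C; rewrite -(twistor_term_perm _ _ _ s) -/g.
pose B (i j : nat) : R := if insub i is Some i' then
  if insub j is Some j' then C i' (g j') else 0 else 0.
have BE (i : 'I_k) (j : 'I_(k + m)) : B i j = C i (g j) by rewrite /B !valK.
have := HB B; rewrite (_ : unit_rows_mx _ _ _ _ = colsub g (lift_mx C l)); last first.
  apply/matrixP => i j; rewrite [RHS]mxE [LHS]mxE; case: (split_ordP i) => i' ->.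
    by rewrite BE col_mxEu.
  rewrite col_mxEd /= addKn LE !mxE -gl.
  by rewrite (inj_eq (increasing_inj incg)) -val_eqE eq_sym.
rewrite (_ : \matrix_(i, j) _ = colsub h C); last first.
  by apply/matrixP => i j; rewrite !mxE -(BE _ (Ordinal _)).
have -> : (-1) ^+ (\sum_(a < m) (k + a + L a)) = (-1) ^+ eps :> R.
  rewrite -(pl g l' incg gl) signr_odd; congr (_ ^+ _); apply: eq_bigr => a _.
  by rewrite LE.
rewrite /twistor_term => ->; rewrite mulrA mulrA -expr2 sqrr_sign mul1r mulrC.
by [].
Qed.

Lemma signed_twistor_expansion eps C l : (k + m)`!%:R *
    ((-1) ^+ eps * \det (col_mx (C *m Z) (rowsub l Z))) =
  \sum_(f : {ffun 'I_(k + m) -> 'I_n}) (-1) ^+ eps * twistor_term C l f.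
Proof.
rewrite mulrCA -mulr_sumr; congr (_ * _).
rewrite (_ : col_mx _ _ = lift_mx C l *m Z) ?cauchy_binet_ffun //.
by rewrite /lift_mx mul_col_mx mul_rowsub_mx mul1mx.
Qed.

Lemma twistor_term_cases eps l : increasing l -> parity_class eps l ->
  forall f, (forall C, twistor_term C l f = 0) \/
  exists beta, exists h : 'I_k -> 'I_n, [/\ 0 < beta, increasing h
    & forall C, (-1) ^+ eps * twistor_term C l f = beta * \det (colsub h C)].
Proof.
move=> incl pl f.
have [/injectiveP injf|ninj] := boolP (injectiveb f); last first.
  by left => C; exact: twistor_term_noninj.
have [/forallP lf|] := boolP [forall a, l a \in codom f]; last first.
  by rewrite negb_forall => /existsP[a la]; left => C; exact: (twistor_term_out _ la).
right; have [beta [h [b0 inch _ _ e]]] := twistor_term_minor incl pl injf lf.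
by exists beta, h.
Qed.

Lemma twistor_ge0 eps l C : increasing l -> parity_class eps l -> nonneg_cols C ->
  0 <= (-1) ^+ eps * \det (col_mx (C *m Z) (rowsub l Z)).
Proof.
move=> incl pl C0; rewrite -(pmulr_rge0 _ (_ : 0 < (k + m)`!%:R)) ?ltr0n ?fact_gt0 //.
rewrite signed_twistor_expansion; apply: sumr_ge0 => f _.
have [->|[b [h [b0 inch ->]]]] := twistor_term_cases incl pl f; first by rewrite mulr0.
by apply: mulr_ge0; [exact: ltW | exact: C0].
Qed.

Definition minor_le C C' := forall h : 'I_k -> 'I_n, increasing h ->
  \det (colsub h C) <= \det (colsub h C').

Lemma twistor_mono eps l C C' : increasing l -> parity_class eps l -> minor_le C C' ->
  (-1) ^+ eps * \det (col_mx (C *m Z) (rowsub l Z)) <=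
  (-1) ^+ eps * \det (col_mx (C' *m Z) (rowsub l Z)).
Proof.
move=> incl pl CC'; rewrite -(ler_pM2l (_ : 0 < (k + m)`!%:R)) ?ltr0n ?fact_gt0 //.
rewrite !signed_twistor_expansion; apply: ler_sum => f _.
have [e|[b [h [b0 inch e]]]] := twistor_term_cases incl pl f; first by rewrite !e.
by rewrite !e ler_pM2l //; exact: CC'.
Qed.

(** The set [l] is completed by indices below [k + m], of which at least [k] lie outside [l]. The
    complementary minor then uses only the first [k + m] columns. *)
Lemma exists_spread l : increasing l -> (k + m <= n)%N ->
  exists f : 'I_(k + m) -> 'I_n, [/\ injective f, forall a, l a \in codom f
    & forall j, (f j < k + m)%N \/ exists a, f j = l a].
Proof.
move=> incl kmn.
pose A := [predD [pred j : 'I_n | j < k + m]%N & mem (codom l)].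
have cA : (k <= #|A|)%N.
  have := cardID (mem (codom l)) [pred j : 'I_n | j < k + m]%N; rewrite -/A.
  have -> : #|[pred j : 'I_n | j < k + m]%N| = (k + m)%N.
    have winj : injective (widen_ord kmn) by move=> i j /(congr1 val) /= /val_inj.
    rewrite -[RHS]card_ord -(card_codom winj); apply: eq_card => j.
    rewrite inE; apply/idP/codomP => [h|[i ->]]; last exact: (ltn_ord i).
    by exists (Ordinal h); exact: val_inj.
  have : (#|[predI [pred j : 'I_n | j < k + m] & mem (codom l)]| <= m)%N.
    rewrite -[X in (_ <= X)%N](card_ord m) -(card_codom (increasing_inj incl)).
    by apply: subset_leq_card; apply/subsetP => j; rewrite !inE => /andP[].
  by move=> h1 h2; rewrite -(leq_add2l m) [(m + k)%N]addnC -h2 leq_add2r.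
have /card_geqP[s [us ss sA]] := cA.
pose t := s ++ codom l.
have st : size t == (k + m)%N by rewrite size_cat ss size_codom card_ord.
have ct : codom (tnth (Tuple st)) = t by rewrite codomE map_tnth_enum.
exists (tnth (Tuple st)); split.
- apply/injectiveP; rewrite /injectiveb /dinjectiveb -codomE ct cat_uniq us /=.
  rewrite (_ : uniq (codom l)) ?andbT; last by apply/injectiveP/increasing_inj.
  apply/hasPn => j /codomP[a ->]; apply/negP => /sA; rewrite !inE.
  by rewrite codom_f.
- by move=> a; rewrite ct mem_cat codom_f orbT.
move=> j; have := mem_tnth j (Tuple st); rewrite mem_cat => /orP[/sA|/codomP[a ->]].
  by rewrite !inE => /andP[_ ?]; left.
by right; exists a.
Qed.

(** All terms of the expansion are nonnegative, and the term of the map from [exists_spread] is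
    positive. *)
Lemma twistor_gt0 eps l C : increasing l -> parity_class eps l -> (k + m <= n)%N ->
  nonneg_cols C ->
  (forall h : 'I_k -> 'I_n, increasing h -> (forall i, (h i < k + m)%N) ->
     0 < \det (colsub h C)) ->
  0 < (-1) ^+ eps * \det (col_mx (C *m Z) (rowsub l Z)).
Proof.
move=> incl pl kmn C0 C1.
rewrite -(pmulr_rgt0 _ (_ : 0 < (k + m)`!%:R)) ?ltr0n ?fact_gt0 //.
rewrite signed_twistor_expansion.
have [f0 [injf lf fr]] := exists_spread incl kmn.
have [b [h [b0 inch hf hl e]]] := twistor_term_minor incl pl injf lf.
rewrite (bigD1 (finfun f0)) //= ltr_pwDl //.
  rewrite (_ : twistor_term _ _ _ = twistor_term C l f0); last first.
    by rewrite /twistor_term; congr (_ * _); congr (\det _); apply/matrixP => i j;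
      rewrite !mxE ffunE.
  rewrite e mulr_gt0 // C1 // => i.
  have /codomP[j hj] := hf i; have [|[a fa]] := fr j; first by rewrite -hj.
  by have := hl i a; rewrite hj fa eqxx.
apply: sumr_ge0 => f _.
have [->|[b' [h' [b'0 inch' ->]]]] := twistor_term_cases incl pl f.
  by rewrite mulr0.
by apply: mulr_ge0; [exact: ltW | exact: C0].
Qed.

End MinorExpansion.

(** * Deformation of C *)

Section ColumnMoves.
Variables (R : realType) (k n : nat).
Implicit Types (C : 'M[R]_(k, n)) (h : 'I_k -> 'I_n).

Definition col_move (i j : 'I_n) C (s : R) : 'M[R]_(k, n) :=
  C + s *: \matrix_(x, y) (if y == j then C x i else 0).

Definition adjacent_ord (i j : 'I_n) := (i.+1 == j :> nat) || (j.+1 == i :> nat).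

Definition updated h b (i : 'I_n) (x : 'I_k) := if x == b then i else h x.

Lemma det_col_move_in i j C s h b : increasing h -> h b = j ->
  \det (colsub h (col_move i j C s)) =
  \det (colsub h C) + s * \det (colsub (updated h b i) C).
Proof.
move=> inch hb; rewrite -det_tr -[in RHS]det_tr -[\det (colsub (updated _ _ _) _)]det_tr.
rewrite (@determinant_multilinear _ _ _ (colsub h C)^T
  (colsub (updated h b i) C)^T b 1 s) ?mul1r //.
- apply/rowP => x; rewrite !mxE hb eqxx /updated eqxx mul1r //.
- apply/matrixP => x y; rewrite !mxE -hb (inj_eq (increasing_inj inch)).
  by rewrite eq_sym (negbTE (neq_lift _ _)) mulr0 addr0.
- apply/matrixP => x y; rewrite !mxE -hb (inj_eq (increasing_inj inch)).
  by rewrite /updated eq_sym (negbTE (neq_lift _ _)) mulr0 addr0.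
Qed.

Lemma det_col_move_out i j C s h : (forall b, h b != j) ->
  \det (colsub h (col_move i j C s)) = \det (colsub h C).
Proof.
move=> hj; congr (\det _); apply/matrixP => x y.
by rewrite !mxE (negbTE (hj y)) mulr0 addr0.
Qed.

Lemma updated_increasing h b i : increasing h -> adjacent_ord i (h b) ->
  (forall x, h x != i) -> increasing (updated h b i).
Proof.
move=> inch adj hi x y xy; rewrite /updated.
have hix : h x != i :> nat by rewrite val_eqE.
have hiy : h y != i :> nat by rewrite val_eqE.
have hxy := inch x y xy; move: adj hix hiy hxy xy; rewrite /adjacent_ord.
by case: (eqVneq x b) => [->|_]; case: (eqVneq y b) => [->|_]; lia.
Qed.

Lemma det_updated_eq0 h b i x C : h x = i -> x != b ->
  \det (colsub (updated h b i) C) = 0.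
Proof.
move=> hx xb; rewrite -det_tr (determinant_alternate xb) // => y.
by rewrite !mxE /updated eqxx (negbTE xb) hx.
Qed.

(** A minor using column [j] grows by [s] times the minor with [i] in place of [j]. By adjacency the
    latter is again in increasing order, hence nonnegative, unless column [i] is repeated and it
    vanishes. *)
Lemma col_move_minor_le i j C s : adjacent_ord i j -> 0 <= s -> nonneg_cols C ->
  minor_le C (col_move i j C s).
Proof.
move=> adj s0 C0 h inch.
have [/forallP hj|] := boolP [forall b, h b != j]; first by rewrite det_col_move_out.
rewrite negb_forall => /existsP[b]; rewrite negbK => /eqP hb.
rewrite (det_col_move_in _ _ _ inch hb) lerDl mulr_ge0 //.
have [/forallP hi|] := boolP [forall x, h x != i].
  by apply: C0; apply: updated_increasing; rewrite ?hb.
rewrite negb_forall => /existsP[x]; rewrite negbK => /eqP hx.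
rewrite (det_updated_eq0 _ hx) //; apply: contraTneq adj => xb.
by rewrite -hx -hb xb /adjacent_ord; lia.
Qed.

Lemma minor_le_nonneg C C' : nonneg_cols C -> minor_le C C' -> nonneg_cols C'.
Proof. by move=> C0 CC' h inch; apply: le_trans (C0 h inch) (CC' h inch). Qed.

Lemma minor_le_trans C1 C2 C3 : minor_le C1 C2 -> minor_le C2 C3 -> minor_le C1 C3.
Proof. by move=> h12 h23 h inch; apply: le_trans (h12 h inch) (h23 h inch). Qed.

Lemma increasing_ge h (x : 'I_k) : increasing h -> (x <= h x)%N.
Proof.
move=> inch; case: x => x; elim: x => [|x IH] hx //.
have hx' : (x < k)%N by apply: ltnW.
by apply: leq_ltn_trans (IH hx') _; apply: inch => /=.
Qed.

(* Both maps are moved down to the inclusion of {0, ..., k - 1}. *)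
Lemma increasing_connected (P : ('I_k -> 'I_n) -> Prop) :
  (forall h b i, increasing h -> increasing (updated h b i) -> adjacent_ord i (h b) ->
     P h <-> P (updated h b i)) ->
  forall h h', increasing h -> increasing h' -> P h -> P h'.
Proof.
move=> step h0 h1 inc0 inc1.
have kn : (k <= n)%N.
  by have /leq_card := increasing_inj inc0; rewrite !card_ord.
suff red h : increasing h -> P h <-> P (widen_ord kn) by move/(red _ inc0)/(red _ inc1).
move: {2}(\sum_x (h x : nat))%N (leqnn (\sum_x (h x : nat))%N) => d.
elim: d h => [|d IH] h.
  move=> s0 inch; rewrite (_ : h = widen_ord kn) //.
  apply/funext => x; apply: val_inj => /=.
  move: s0; rewrite leqn0 sum_nat_eq0 => /forallP/(_ x)/eqP => hx.
  by apply/eqP; rewrite eqn_leq (increasing_ge x inch) hx.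
move=> sd inch; have [/forallP hE|] := boolP [forall x : 'I_k, h x == x :> nat].
  by rewrite (_ : h = widen_ord kn) //; apply/funext => x; apply: val_inj; exact/eqP/hE.
rewrite negb_forall => /existsP[x0 hx0].
pose b := [arg min_(y < x0 | h y != y :> nat) (y : nat)]%N.
have [hb bmin] : h b != b :> nat /\ forall y : 'I_k, (y < b)%N -> h y = y :> nat.
  rewrite /b; case: arg_minnP => // y hy ymin; split => // z zy; apply/eqP.
  by apply: contraLR zy => hz; rewrite -leqNgt; exact: ymin.
have hb' : (b < h b)%N by rewrite ltn_neqAle eq_sym hb increasing_ge.
have hn : ((h b).-1 < n)%N by apply: leq_ltn_trans (leq_pred _) (ltn_ord _).
pose i := Ordinal hn.
have adj : adjacent_ord i (h b) by rewrite /adjacent_ord /= prednK ?eqxx //; lia.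
have hi x : h x != i.
  rewrite -val_eqE /=; apply/eqP => hx.
  have xb : (x < b)%N by rewrite -(increasing_leq _ _ inch); lia.
  by have := bmin _ xb; lia.
have inci := updated_increasing inch adj hi.
rewrite (step h b i inch inci adj); apply: IH => //.
have -> : (\sum_x (updated h b i x : nat) = (h b).-1 + \sum_(x < k | x != b) h x)%N.
  rewrite (bigD1 b) //= {1}/updated eqxx; congr (_ + _)%N.
  by apply: eq_bigr => x /negbTE xb; rewrite /updated xb.
move: sd hb'; rewrite (bigD1 b) //=.
by move: (\sum_(x < k | x != b) h x)%N => S; clear; lia.
Qed.

End ColumnMoves.

(** * Parity of the coarse facets *)

Lemma odd_sum_pairs q (F : nat -> nat) :
  (forall s, (s < q)%N -> ~~ odd (F s.*2 + F s.*2.+1)) ->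
  ~~ odd (\sum_(a < q.*2) F a).
Proof.
elim: q => [|q IH] h; first by rewrite big_ord0.
rewrite doubleS !big_ord_recr /= -addnA oddD (negbTE (h q _)) // addbF.
by apply: IH => s sq; apply: h; exact: ltnW.
Qed.

Lemma sum_ends (F : nat -> nat) N p : p = N.+1 ->
  (\sum_(a < p.+1) F a = F 0 + \sum_(a < N) F a.+1 + F p)%N.
Proof. by move=> ->; rewrite big_ord_recl big_ord_recr /= addnA. Qed.

Lemma increasing_consecutive p n (g : 'I_p -> 'I_n) x y : increasing g ->
  (g x).+1 = g y :> nat -> y = x.+1 :> nat.
Proof.
move=> incg gxy; have xy : (x < y)%N by rewrite -(increasing_leq _ _ incg) -gxy.
have x1p : (x.+1 < p)%N by apply: leq_ltn_trans xy (ltn_ord y).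
apply/eqP; rewrite eqn_leq xy andbT leqNgt; apply/negP => h.
have := incg x (Ordinal x1p) (ltnSn _); have := incg (Ordinal x1p) y h; lia.
Qed.

Section CoarseFacets.
Variables (n k p : nat).
Implicit Types (l : 'I_p.+1 -> 'I_n).

Definition nat_of_fun q (l' : 'I_p.+1 -> 'I_q) (a : nat) : nat :=
  if insub a is Some a' then l' a' else 0%N.

Lemma nat_of_funE q (l' : 'I_p.+1 -> 'I_q) (a : 'I_p.+1) : nat_of_fun l' a = l' a.
Proof. by rewrite /nat_of_fun valK. Qed.

Lemma nat_of_fun_lt q (l' : 'I_p.+1 -> 'I_q) a (ha : (a < p.+1)%N) :
  nat_of_fun l' a = l' (Ordinal ha).
Proof. by rewrite -[a]/(val (Ordinal ha)) nat_of_funE. Qed.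

(** Consecutive indices also have consecutive positions in any increasing [g] containing them, so
    each pair contributes an even number. *)
Lemma parity_class_pairs q l : p.+1 = q.*2 ->
  (forall a b : 'I_p.+1, ~~ odd a -> b = a.+1 :> nat -> l b = (l a).+1 :> nat) ->
  parity_class k false l.
Proof.
move=> pq hl g l' incg gl; apply: negbTE.
rewrite (eq_bigr (fun a : 'I_p.+1 => k + a + nat_of_fun l' a)%N) => [|a _]; last first.
  by rewrite nat_of_funE.
have := @odd_sum_pairs q (fun a => k + a + nat_of_fun l' a)%N.
rewrite -pq; apply => s sq.
have h0 : (s.*2 < p.+1)%N by lia.
have h1 : (s.*2.+1 < p.+1)%N by lia.
rewrite (nat_of_fun_lt _ h0) (nat_of_fun_lt _ h1).
have -> : l' (Ordinal h1) = (l' (Ordinal h0)).+1 :> nat.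
  apply: (increasing_consecutive incg); rewrite !gl; apply/esym/hl => //=.
  by rewrite odd_double.
lia.
Qed.

(** The extreme indices must occupy the extreme positions 0 and [k + p], which contribute [k] and an
    even number; the pairs in between contribute evenly. *)
Lemma parity_class_cyclic q l : p.+1 = q.+1.*2 ->
  l ord0 = 0%N :> nat -> (l ord_max).+1 = n ->
  (forall a b : 'I_p.+1, odd a -> b = a.+1 :> nat -> (b < p)%N ->
     l b = (l a).+1 :> nat) ->
  parity_class k (odd k) l.
Proof.
move=> pq l0 lmax hl g l' incg gl.
rewrite (eq_bigr (fun a : 'I_p.+1 => k + a + nat_of_fun l' a)%N) => [|a _]; last first.
  by rewrite nat_of_funE.
have pE : p = q.*2.+1 by lia.
rewrite (sum_ends (fun a => k + a + nat_of_fun l' a)%N pE).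
have hp : (p < p.+1)%N by [].
rewrite (nat_of_fun_lt _ (ltn0Sn p)) (nat_of_fun_lt _ hp).
have -> : l' (Ordinal (ltn0Sn p)) = 0%N :> nat.
  have := increasing_ge (l' (Ordinal (ltn0Sn p))) incg; rewrite gl.
  by rewrite (_ : Ordinal _ = ord0) ?l0; [lia | exact: val_inj].
have -> : l' (Ordinal hp) = (k + p)%N :> nat.
  rewrite (_ : Ordinal hp = ord_max); last exact: val_inj.
  apply/eqP; rewrite eqn_leq; apply/andP; split.
    by have := ltn_ord (l' ord_max); lia.
  rewrite leqNgt; apply/negP => h.
  have hb : (k + p < k + p.+1)%N by rewrite addnS.
  have := incg (l' ord_max) (Ordinal hb) h; rewrite gl.
  by have := ltn_ord (g (Ordinal hb)); lia.
have := @odd_sum_pairs q (fun a => k + a.+1 + nat_of_fun l' a.+1)%N.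
set S := (\sum_(a < q.*2) _)%N => HS.
have /negbTE oS : ~~ odd S.
  apply: HS => s sq.
  have h1 : (s.*2.+1 < p.+1)%N by lia.
  have h2 : (s.*2.+2 < p.+1)%N by lia.
  rewrite (nat_of_fun_lt _ h1) (nat_of_fun_lt _ h2).
  have -> : l' (Ordinal h2) = (l' (Ordinal h1)).+1 :> nat.
    apply: (increasing_consecutive incg); rewrite !gl; apply/esym/hl => //=.
      by rewrite odd_double.
    by lia.
  lia.
by rewrite !oddD oS; case: (odd k); case: (odd p).
Qed.

(** Passes from lists with entries starting at 1 to maps into ordinals starting at 0. *)
Lemma list_increasing (R : realType) (Z : 'M[R]_(n, k + p.+1)) I :
  size I = p.+1 -> sorted ltn I -> all (fun i => 1 <= i < 1 + n)%N I ->
  exists l, [/\ increasing l, forall a, (l a).+1 = nth 0%N I a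
    & zmx Z I = rowsub l Z].
Proof.
move=> sI oI /allP aI.
have hI (a : 'I_p.+1) : ((nth 0 I a).-1 < n)%N /\ (0 < nth 0 I a)%N.
  have /aI : nth 0%N I a \in I by rewrite mem_nth // sI.
  by lia.
exists (fun a => Ordinal (hI a).1); split=> [a b ab|a|] /=.
- have := sorted_ltn_nth ltn_trans 0%N oI; move=> /(_ a b).
  rewrite !inE sI !ltn_ord => /(_ isT isT ab) /=.
  by have := (hI a).2; have := (hI b).2; lia.
- by rewrite prednK //; exact: (hI a).2.
apply/row_matrixP => a; rewrite rowK row_rowsub /zrow.
by rewrite insubT ?(hI a).1 // => h; congr (row _ Z); exact: val_inj.
Qed.

Lemma nth_pairs j s : (s < size j)%N ->
  nth 0%N (pairs j) s.*2 = nth 0%N j s /\ nth 0%N (pairs j) s.*2.+1 = (nth 0%N j s).+1.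
Proof. by elim: j s => [|a j IH] [|s] //= hs; apply: IH. Qed.

Lemma paired_facet (R : realType) (Z : 'M[R]_(n, k + p.+1)) q len a I :
  I \in paired q len a -> p.+1 = q.*2 -> (0 < a)%N -> (a + len <= n.+1)%N ->
  exists l, [/\ increasing l, parity_class k false l,
    forall a, (l a).+1 = nth 0%N I a & zmx Z I = rowsub l Z].
Proof.
move=> /[dup] /size_paired sI /mem_pairedP[j [Ij sj oI aI]] pq a0 alen.
have szI : size I = p.+1 by rewrite sI pq.
have aI' : all (fun i => 1 <= i < 1 + n)%N I by apply: sub_all aI => i /=; lia.
have [l [incl lE ZE]] := list_increasing Z szI oI aI'.
exists l; split => //; apply: parity_class_pairs pq _ => x y ox yx.
apply: succn_inj; rewrite !lE yx Ij.
have xE : nat_of_ord x = x./2.*2 by rewrite -[LHS]odd_double_half (negbTE ox).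
have xs : (x./2 < size j)%N by have := ltn_ord x; rewrite sj; lia.
by rewrite xE; have [-> ->] := nth_pairs xs.
Qed.

Lemma cyclic_facet (R : realType) (Z : 'M[R]_(n, k + p.+1)) q len J :
  J \in paired q len 2 -> p.+1 = q.+1.*2 -> (len.+2 <= n)%N ->
  exists l, [/\ increasing l, parity_class k (odd k) l,
    forall a, (l a).+1 = nth 0%N (1%N :: rcons J n) a
    & zmx Z (1%N :: rcons J n) = rowsub l Z].
Proof.
move=> /[dup] /size_paired sJ /mem_pairedP[j [Jj sj oJ aJ]] pq lenn.
have pE : p = q.*2.+1 by lia.
have sI : size (1%N :: rcons J n) = p.+1 by rewrite /= size_rcons sJ pq doubleS.
have oI : sorted ltn (1%N :: rcons J n).
  rewrite /= path_sortedE; last exact: ltn_trans.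
  apply/andP; split.
    rewrite all_rcons /=; apply/andP; split; first lia.
    by apply: sub_all aJ => i /=; lia.
  rewrite (sorted_pairwise ltn_trans) pairwise_rcons -(sorted_pairwise ltn_trans).
  rewrite oJ andbT.
  by apply: sub_all aJ => i /=; lia.
have aI : all (fun i => 1 <= i < 1 + n)%N (1%N :: rcons J n).
  rewrite /= all_rcons /=; apply/and3P; split; [lia|lia|].
  by apply: sub_all aJ => i /=; lia.
have [l [incl lE ZE]] := list_increasing Z sI oI aI.
exists l; split => //; apply: parity_class_cyclic pq _ _ _.
- by apply: succn_inj; rewrite lE.
- rewrite lE; have -> : nat_of_ord (ord_max : 'I_p.+1) = q.*2.+1 by rewrite -pE.
  by rewrite /= nth_rcons sJ ltnn eqxx.
move=> x y ox yx yp; apply: succn_inj; rewrite !lE yx /=.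
have xE : nat_of_ord x = x./2.*2.+1 by rewrite -[LHS]odd_double_half ox.
have xs : (x./2 < size j)%N by rewrite sj; lia.
rewrite xE /= !nth_rcons sJ Jj.
have -> : (x./2.*2 < q.*2)%N by rewrite ltn_double -sj.
have -> : (x./2.*2.+1 < q.*2)%N by lia.
by have [-> ->] := nth_pairs xs.
Qed.

End CoarseFacets.

(** * Continuity of twistor coordinates along segments *)

Section AffineFamilies.
Variable R : realType.

Lemma continuous_det q (M : R -> 'M[R]_q) :
  (forall i j, continuous (fun t => M t i j)) -> continuous (fun t => \det (M t)).
Proof.
move=> cM; apply: continuous_big => [|s _]; first exact: add_continuous.
have cp : continuous (fun t => \prod_i M t i (s i)).
  by apply: continuous_big => [|i _]; [exact: mul_continuous|exact: cM].
by move=> t; apply: cvgM; [exact: cvg_cst|exact: cp].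
Qed.

Lemma continuous_tw_affine k p (Y0 D : 'M[R]_(k, k + p.+1)) F :
  continuous (fun t : R => tw (Y0 + t *: D) F).
Proof.
apply: continuous_det => i j t; case: (split_ordP i) => i' ->.
  rewrite (_ : (fun t => _) = (fun t => Y0 i' j + t * D i' j)); last first.
    by apply/funext => s; rewrite col_mxEu !mxE.
  apply: cvgD; first exact: cvg_cst.
  by apply: cvgMr_tmp; exact: cvg_id.
rewrite (_ : (fun t => _) = cst (F i' j)); first exact: cvg_cst.
by apply/funext => s; rewrite col_mxEd.
Qed.

End AffineFamilies.

(** * Reduction to C = [B, 0] *)

Section Reduction.
Variables (R : realType) (n k r p : nat).
Hypotheses (pr : p.+1 = r.+1.*2) (kpn : (k + p.+1 <= n)%N).
Variable Z : 'M[R]_(n, k + p.+1).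
Hypothesis hZ : positive_rows Z.
Variable w : int.
Implicit Types (C : 'M[R]_(k, n)) (h : 'I_k -> 'I_n).

Notation W C := (has_winding_number Z (C *m Z) w).
Notation offc := (@off_coarse R n k r p Z).

Definition good C := nonneg_cols C /\ offc (C *m Z).

Lemma coarse_facet_sign F : F \in coarse_facets r Z ->
  exists eps l, [/\ increasing l, parity_class k eps l & F = rowsub l Z].
Proof.
rewrite mem_cat => /orP[/mapP[I hI ->]|/mapP[J hJ ->]].
  have [||l [incl pl _ ZE]] := paired_facet Z hI pr; [by []|by rewrite add1n|].
  by exists false, l.
have [|l [incl pl _ ZE]] := cyclic_facet Z hJ pr; first by lia.
by exists (odd k), l.
Qed.

(** The signed coarse coordinates are positive at [C] and do not decrease when the minors grow. *)
Lemma good_le C C' : good C -> minor_le C C' -> good C'.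
Proof.
move=> [C0 oC] CC'; split; first exact: minor_le_nonneg CC'.
move=> F hF; have [eps [l [incl pl FE]]] := coarse_facet_sign hF.
have := oC F hF; rewrite FE /tw => tC.
have := twistor_ge0 hZ incl pl C0; rewrite le_eqVlt eq_sym.
rewrite mulf_eq0 signr_eq0 (negbTE tC) /= => tC0.
have := lt_le_trans tC0 (twistor_mono hZ incl pl CC').
by apply: contraTneq => ->; rewrite mulr0 ltxx.
Qed.

Lemma good_pos C : nonneg_cols C ->
  (forall h, increasing h -> (forall i, (h i < k + p.+1)%N) -> 0 < \det (colsub h C)) ->
  good C.
Proof.
move=> C0 C1; split => // F hF; have [eps [l [incl pl ->]]] := coarse_facet_sign hF.
have := twistor_gt0 hZ incl pl kpn C0 C1.
by apply: contraTneq; rewrite /tw => ->; rewrite mulr0 ltxx.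
Qed.

Lemma winding_affine C D : (forall t : R, 0 <= t <= 1 -> good (C + t *: D)) ->
  W (C + D) -> W C.
Proof.
move=> gC; have pn : (p.+1 <= n)%N by lia.
have := @winding_homotopy R n k r p pr pn Z (fun t => C *m Z + t *: (D *m Z)) _ _ w.
rewrite scale1r scale0r addr0 -mulmxDl; apply => [F|t t01].
  exact: continuous_tw_affine.
by rewrite scalemxAl -mulmxDl; have [] := gC t t01.
Qed.

Lemma winding_col_move C i j : adjacent_ord i j -> good C -> W (col_move i j C 1) -> W C.
Proof.
move=> adj gC; rewrite /col_move scale1r; apply: winding_affine => t /andP[t0 _].
by apply: (good_le gC); apply: col_move_minor_le => //; case: gC.
Qed.

Lemma exists_pos_minor C : \rank C = k -> nonneg_cols C ->
  exists h, increasing h /\ 0 < \det (colsub h C).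
Proof.
move=> rC C0; have fC : row_full C^T by rewrite /row_full mxrank_tr rC.
have := fullrowsub_unit fC; have := @fullrankfun_inj _ _ _ _ fC.
set f := fullrankfun fC => injf uf.
have [s incs] := sort_injective injf; exists (f \o s); split => //.
rewrite lt_neqAle eq_sym C0 // andbT det_colsub_perm mulf_eq0 signr_eq0 /=.
rewrite -det_tr (_ : (colsub f C)^T = rowsub f C^T); last by rewrite trmx_mxsub.
by rewrite -unitfE -unitmxE.
Qed.

(** The matrix [C'] results from [C] by column moves; the winding number is pulled back from [C'] to
    [C]. *)
Definition reach C (h : 'I_k -> 'I_n) := exists C',
  [/\ good C', minor_le C C', W C' -> W C & 0 < \det (colsub h C')].

(** Adding column [h b] to column [i] adds the positive minor at [h] to the nonnegative minor at the
    updated map. *)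
Lemma reach_step C h b i : increasing h -> increasing (updated h b i) ->
  adjacent_ord i (h b) -> reach C h -> reach C (updated h b i).
Proof.
move=> inch inch' adj [C' [gC' CC' WC hC']].
have adj' : adjacent_ord (h b) i by move: adj; rewrite /adjacent_ord orbC.
have [C'0 _] := gC'.
exists (col_move (h b) i C' 1); split.
- by apply: (good_le gC'); exact: col_move_minor_le.
- by apply: (minor_le_trans CC'); exact: col_move_minor_le.
- by move=> W'; apply: WC; exact: (winding_col_move adj' gC' W').
rewrite (det_col_move_in _ _ _ inch' (_ : updated h b i b = i)) ?mul1r; last first.
  by rewrite /updated eqxx.
rewrite ltr_wpDl ?C'0 //.
rewrite (_ : updated _ _ _ = h) //.
by apply/funext => x; rewrite /updated; case: eqP => [->|].
Qed.

Lemma reach_all C h0 h : good C -> increasing h0 -> 0 < \det (colsub h0 C) ->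
  increasing h -> reach C h.
Proof.
move=> gC inc0 p0 inch.
apply: (increasing_connected _ inc0 inch); last by exists C; split.
move=> h1 b i inc1 inc1' adj; split; first exact: reach_step.
set h2 := updated h1 b i in inc1' *.
have e : updated h2 b (h1 b) = h1.
  by apply/funext => x; rewrite /h2 /updated; case: eqP => [->|].
move=> H; rewrite -e; apply: reach_step; rewrite ?e //.
by rewrite /h2 /updated eqxx; move: adj; rewrite /adjacent_ord orbC.
Qed.

(** Since minors never decrease, positivity gained for one index set persists while the others are
    treated. *)
Lemma reach_seq C h0 (hs : seq {ffun 'I_k -> 'I_n}) :
  good C -> increasing h0 -> 0 < \det (colsub h0 C) ->
  exists C', [/\ good C', minor_le C C', W C' -> W C
    & {in hs, forall h : {ffun 'I_k -> 'I_n}, increasing h -> 0 < \det (colsub h C')}].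
Proof.
move=> gC inc0 p0; elim: hs => [|h hs [C1 [g1 le1 W1 p1]]]; first by exists C; split.
have [inch|ninch] := pselect (increasing h); last first.
  by exists C1; split => // h'; rewrite in_cons => /orP[/eqP-> //|/p1].
have [C2 [g2 le2 W2 p2]] := reach_all g1 inc0 (lt_le_trans p0 (le1 h0 inc0)) inch.
exists C2; split => //; first exact: minor_le_trans le2.
  by move=> W2'; apply/W1/W2.
move=> h'; rewrite in_cons => /orP[/eqP-> //|/p1 p1' inc'].
exact: lt_le_trans (p1' inc') (le2 _ inc').
Qed.

Lemma reach_positive C : \rank C = k -> good C ->
  exists C', [/\ good C', W C' -> W C
    & forall h, increasing h -> 0 < \det (colsub h C')].
Proof.
move=> rC gC; have [h0 [inc0 p0]] := exists_pos_minor rC gC.1.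
have [C' [gC' _ WC pos]] := reach_seq (enum {: {ffun 'I_k -> 'I_n}}) gC inc0 p0.
exists C'; split => // h inch.
rewrite (_ : colsub h C' = colsub (finfun h) C').
  by apply: pos; rewrite ?mem_enum // => i j ij; rewrite !ffunE; exact: inch.
by apply/matrixP => i j; rewrite !mxE ffunE.
Qed.

(** Once all minors are positive, the columns of index at least [k + p.+1] are scaled by [1 - t].
    The minors on the first columns do not change, and their positivity keeps the path off the
    coarse boundary up to and including [t = 1]. *)
Lemma winding_truncate C : \rank C = k -> good C ->
  (forall B, nonneg_cols B ->
     (forall h, increasing h -> (forall i, (h i < k + p.+1)%N) ->
        0 < \det (colsub h B)) ->
     (forall x (y : 'I_n), (k + p.+1 <= y)%N -> B x y = 0) -> W B) ->
  W C.
Proof.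
move=> rC gC final; have [C' [gC' WC pos]] := reach_positive rC gC; apply: WC.
pose D : 'M[R]_(k, n) := \matrix_(x, y) if (y < k + p.+1)%N then 0 else - C' x y.
pose d t (y : 'I_n) : R := if (y < k + p.+1)%N then 1 else 1 - t.
have minorE t h : \det (colsub h (C' + t *: D)) =
    (\prod_(i < k) d t (h i)) * \det (colsub h C').
  have -> : colsub h (C' + t *: D) = colsub h C' *m diag_mx (\row_i d t (h i)).
    apply/matrixP => x y; rewrite mul_mx_diag !mxE /d.
    by case: ifP => _; rewrite ?mulr0 ?addr0 ?mulr1 // mulrBr mulr1 mulrN mulrC.
  rewrite det_mulmx det_diag mulrC; congr (_ * _).
  by apply: eq_bigr => i _; rewrite mxE.
have pr1 t h : (forall i, (h i < k + p.+1)%N) -> \prod_(i < k) d t (h i) = 1.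
  by move=> hlt; rewrite big1 // => i _; rewrite /d hlt.
have nn t : 0 <= t <= 1 -> nonneg_cols (C' + t *: D).
  move=> t01 h inch; rewrite minorE mulr_ge0 ?(ltW (pos _ inch)) //.
  by apply: prodr_ge0 => i _; rewrite /d; case: ifP => _; lra.
have pp t h : increasing h -> (forall i, (h i < k + p.+1)%N) ->
    0 < \det (colsub h (C' + t *: D)).
  by move=> inch hlt; rewrite minorE pr1 // mul1r pos.
apply: (@winding_affine C' D) => [t t01|].
  by apply: good_pos => [|h inch hlt]; [exact: nn|exact: pp].
rewrite -[D]scale1r; apply: final => [|h inch hlt|x y hy].
- by apply: nn; rewrite ler01 lexx.
- exact: pp.
by rewrite !mxE ltnNge hy /= mul1r addrN.
Qed.

End Reduction.

(** * The count for C = [B, 0] *)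

Section CountLists.

(* For a concatenation of pairs (i, i + 1) starting at position 0, the second
   condition says that all the i are even. *)
Definition alternating_list (N : nat) (I : seq nat) :=
  all (fun x => x <= N)%N I && all (fun i => ~~ odd (i + nth 0%N I i)) (iota 0 (size I)).

Lemma alternating_list_cons2 N a b I :
  alternating_list N [:: a, b & I] =
  [&& (a <= N)%N, (b <= N)%N, ~~ odd a, odd b & alternating_list N I].
Proof.
rewrite /alternating_list /= !add0n negbK.
rewrite (iotaDl 2 0) all_map (@eq_all _ (preim _ _) (fun i => ~~ odd (i + nth 0%N I i))).
  by case: (_ <= _)%N; case: (_ <= _)%N; case: odd; case: odd; rewrite ?andbF ?andbT.
by move=> i /=; rewrite !negbK.
Qed.

(** Such a list is a choice of [q] among the disjoint pairs {a, a + 1}, {a + 2, a + 3}, ...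
    contained in the interval from [a] to [N]. The recursion is Pascal's rule for using or skipping
    the first pair. *)
Lemma count_alternating N q len a : ~~ odd a -> (N < a + len)%N ->
  count (alternating_list N) (paired q len a) = 'C((N.+1 - a)./2, q).
Proof.
elim/ltn_ind: len q a => len IH [|q] a oa Na; first by rewrite paired0 bin0.
case: len IH Na => [|[|len]] IH Na.
- by rewrite (_ : N.+1 - a = 0)%N //; lia.
- by rewrite (_ : (N.+1 - a)./2 = 0)%N //; lia.
rewrite pairedSS count_cat count_map.
(* Lists starting at the odd number [a.+1] are not alternating. *)
have -> : count (alternating_list N) (paired q.+1 len.+1 a.+1) =
    count (alternating_list N) (paired q.+1 len a.+2).
  case: len {IH Na} => [|len] //; rewrite pairedSS count_cat count_map.
  rewrite (eq_count (a2 := pred0)) ?count_pred0 // => J /=.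
  by rewrite alternating_list_cons2 /= oa /= !andbF.
rewrite (IH len) //=; [|lia|lia].
have [aN|aN] := leqP a.+1 N.
  rewrite (eq_count (a2 := alternating_list N)) => [|J /=]; last first.
    by rewrite alternating_list_cons2 aN (ltnW aN) oa /= oa.
  rewrite IH //=; [|lia|lia].
  have -> : ((N.+1 - a)./2 = ((N.+1 - a.+2)./2).+1)%N by lia.
  by rewrite binS addnC.
rewrite (eq_count (a2 := pred0)) ?count_pred0 => [|J /=]; last first.
  by rewrite alternating_list_cons2 (leqNgt a.+1) aN andbF.
have -> : ((N.+1 - a)./2 = 0)%N by lia.
by have -> : ((N.+1 - a.+2)./2 = 0)%N by lia.
Qed.

End CountLists.

(** * Reordering rows in twistor coordinates *)

Section MoveRows.
Variables (R : realType) (n k p : nat) (Z : 'M[R]_(n, k + p.+1)).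
Variable Y : 'M[R]_(k, k + p.+1).

Lemma tw_swap s1 a b s2 : size (s1 ++ a :: b :: s2) = p.+1 ->
  tw Y (zmx Z (s1 ++ a :: b :: s2)) = - tw Y (zmx Z (s1 ++ b :: a :: s2)).
Proof.
rewrite size_cat /= => sz.
have h0 : (size s1 < p.+1)%N by lia.
have h1 : ((size s1).+1 < p.+1)%N by lia.
pose i0 := rshift k (Ordinal h0); pose i1 := rshift k (Ordinal h1).
have i01 : i0 != i1 by rewrite -val_eqE /=; lia.
suff E : col_mx Y (zmx Z (s1 ++ a :: b :: s2)) =
    perm_mx (tperm i0 i1) *m col_mx Y (zmx Z (s1 ++ b :: a :: s2)).
  by rewrite /tw E det_mulmx det_perm odd_tperm i01 expr1 mulN1r.
rewrite -row_permE row_permEsub; apply/row_matrixP => x; rewrite row_rowsub.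
case: (split_ordP x) => y ->.
  by rewrite tpermD ?rowKu // eq_sym eq_lrshift.
rewrite rowKd rowK; case: tpermP => [/rshift_inj->|/rshift_inj->|/eqP y0 /eqP y1].
- by rewrite rowKd rowK /= !nth_cat ltnn subnn ltnNge leqnSn subSn // subnn.
- by rewrite rowKd rowK /= !nth_cat ltnn subnn ltnNge leqnSn subSn // subnn.
rewrite rowKd rowK !nth_cat; case: ltnP => // hy; congr (zrow Z _).
move: y0 y1; rewrite !eq_rshift -!val_eqE /= => y0 y1.
by have -> : (y - size s1 = (y - (size s1).+2).+2)%N by lia.
Qed.

Lemma tw_move s1 a s2 : size (s1 ++ a :: s2) = p.+1 ->
  tw Y (zmx Z (s1 ++ a :: s2)) = (-1) ^+ size s1 * tw Y (zmx Z (a :: s1 ++ s2)).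
Proof.
elim/last_ind: s1 s2 => [|s1 b IH] s2 sz; first by rewrite expr0 mul1r.
rewrite size_rcons exprS mulN1r mulNr !cat_rcons tw_swap; last by rewrite -cat_rcons.
congr (- _); rewrite IH //; move: sz.
by rewrite !size_cat size_rcons /= => <-; rewrite addSnnS.
Qed.

Lemma set_row_zmx (i : 'I_p.+1) b I : size I = p.+1 ->
  set_row i (zrow Z b) (zmx Z I) = zmx Z (take i I ++ b :: drop i.+1 I).
Proof.
move=> sI; apply/row_matrixP => x; rewrite !rowK; have ip := ltn_ord i.
rewrite nth_cat size_takel ?sI ?(ltnW ip) //; case: eqP => [->|/eqP xi].
  by rewrite ltnn subnn.
case: ltnP => hx; first by rewrite nth_take.
have xi' : (i < x)%N by rewrite ltn_neqAle hx andbT eq_sym.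
have -> : (x - i = (x - i.+1).+1)%N by lia.
by rewrite /= nth_drop subnKC.
Qed.

End MoveRows.

(** Both [g] and its conjugate by the order reversal dominate the identity. *)
Lemma increasing_id N (g : 'I_N -> 'I_N) x : increasing g -> g x = x.
Proof.
move=> incg; apply: val_inj; apply/eqP; rewrite eqn_leq (increasing_ge x incg) andbT.
have incr : increasing (fun y => rev_ord (g (rev_ord y))).
  move=> i j ij; have := incg (rev_ord j) (rev_ord i).
  have := ltn_ord (g (rev_ord j)); have := ltn_ord (g (rev_ord i)).
  by have := ltn_ord i; have := ltn_ord j; rewrite /=; lia.
have := increasing_ge (rev_ord x) incr; rewrite rev_ordK /=.
by have := ltn_ord x; have := ltn_ord (g x); lia.
Qed.

(** * Signs of twistor coordinates for C = [B, 0] *)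

Section FinalCount.
Variables (R : realType) (n k r p : nat).
Hypotheses (pr : p.+1 = r.+1.*2) (kpn : (k + p.+1 <= n)%N).
Variable Z : 'M[R]_(n, k + p.+1).
Hypothesis hZ : positive_rows Z.
Variable B : 'M[R]_(k, n).
Hypothesis B_ge0 : nonneg_cols B.
Hypothesis B_gt0 : forall h : 'I_k -> 'I_n, increasing h ->
  (forall i, (h i < k + p.+1)%N) -> 0 < \det (colsub h B).
Hypothesis B_eq0 : forall x (y : 'I_n), (k + p.+1 <= y)%N -> B x y = 0.

Notation T s := (tw (B *m Z) (zmx Z s)).

Section Restriction.
Variable l : nat.
Hypotheses (kpl : (k + p.+1 <= l)%N) (ln : (l <= n)%N).

Let Zl : 'M[R]_(l, k + p.+1) := rowsub (widen_ord ln) Z.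
Let Bl : 'M[R]_(k, l) := colsub (widen_ord ln) B.

Let widen_increasing q (f : 'I_q -> 'I_l) :
  increasing f -> increasing (widen_ord ln \o f).
Proof. by move=> incf i j /incf. Qed.

Let mul_restrict : Bl *m Zl = B *m Z.
Proof.
apply/matrixP => x y; rewrite !mxE [RHS](bigID (fun j : 'I_n => (j < l)%N)) /=.
rewrite [X in _ = _ + X]big1 ?addr0 => [|j jl]; last first.
  by rewrite B_eq0 ?mul0r // (leq_trans kpl) // leqNgt.
rewrite (big_ord_narrow ln) /=; apply: eq_bigr => j _.
by rewrite !mxE.
Qed.

(** Since the columns of [B] from [k + p.+1] on vanish, only the first [l] rows of [Z] enter
    [B *m Z]. Hence [l] can play the role of [n], in particular that of the last vertex. *)
Lemma restricted_sign s (f : 'I_p.+1 -> 'I_l) eps : increasing f ->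
  (forall a, (f a).+1 = nth 0%N s a) -> parity_class k eps f ->
  0 < (-1) ^+ eps * T s.
Proof.
move=> incf fE pf; rewrite -mul_restrict.
have -> : zmx Z s = rowsub f Zl.
  apply/row_matrixP => a; rewrite rowK !row_rowsub /zrow -fE.
  case: insubP => [u _ hu|]; last by rewrite (leq_trans (ltn_ord (f a))).
  by congr (row _ Z); apply: val_inj; rewrite /= hu.
apply: (twistor_gt0 _ incf pf kpl).
- by move=> g /widen_increasing /hZ; rewrite rowsub_comp.
- by move=> h /widen_increasing /B_ge0; rewrite colsub_comp.
move=> h inch hlt; have := B_gt0 (widen_increasing inch) hlt.
by rewrite colsub_comp.
Qed.

End Restriction.

Lemma paired_sign I len a : I \in paired r.+1 len a -> (0 < a)%N -> (a + len <= n.+1)%N ->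
  0 < T I.
Proof.
move=> hI a0 alen; have [l [incl pl _ ->]] := paired_facet Z hI pr a0 alen.
by have := twistor_gt0 hZ incl pl kpn B_ge0 B_gt0; rewrite expr0 mul1r.
Qed.

Lemma cyclic_sign J l : (k + p.+1 <= l <= n)%N -> J \in paired r l.-2 2 ->
  0 < (-1) ^+ k * T (1%N :: rcons J l).
Proof.
move=> /andP[kl ln] hJ; rewrite -signr_odd.
have l2 : (l.-2.+2 <= l)%N by lia.
have [f [incf pf fE _]] := cyclic_facet (rowsub (widen_ord ln) Z) hJ pr l2.
exact: (restricted_sign kl ln incf fE pf).
Qed.

Lemma odd_sumn_nth (s : seq nat) : odd (sumn s) = odd (\sum_(a < size s) nth 0%N s a).
Proof. by rewrite sumnE (big_nth 0%N) big_mkord. Qed.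

Lemma sorted_sign s : size s = p.+1 -> sorted ltn s ->
  all (fun i => 1 <= i < 1 + (k + p.+1))%N s ->
  0 < (-1) ^+ (\sum_(a < p.+1) (k + a + nth 0%N s a)) * T s.
Proof.
move=> sz os al.
have [f [incf fE _]] := list_increasing (rowsub (widen_ord kpn) Z) sz os al.
have pf : parity_class k (odd (\sum_(a < p.+1) (k + a + nth 0%N s a))) f.
  move=> g l' incg gl.
  (* With [l = k + p.+1] the only increasing [g] is the identity, so positions are entries minus 1;
     the [p.+1] shifts by 1 preserve the parity because [p.+1] is even. *)
  rewrite [in RHS](eq_bigr (fun a : 'I_p.+1 => (k + a + l' a) + 1)%N);
    last by move=> a _; rewrite -fE -gl increasing_id // addn1 addnS.
  rewrite [X in _ = odd X]big_split /= oddD big_const_ord iter_addn_0 mul1n.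
  by rewrite [in X in _ (+) X]pr odd_double addbF.
by have := restricted_sign (leqnn _) kpn incf fE pf; rewrite signr_odd.
Qed.

Lemma odd_index_sum (s : seq nat) : size s = p.+1 ->
  odd (\sum_(a < p.+1) (k + a + nth 0%N s a)) =
  odd (\sum_(a < p.+1) (k + a)) (+) odd (sumn s).
Proof.
by move=> sz; rewrite big_split oddD odd_sumn_nth sz.
Qed.

(** Moving vertex 1 to the front costs the sign of [i]. The sign exponents of the resulting list and
    of [I] differ in parity by [1 + nth 0 I i], and the exponent of [I] is even since its coordinate
    is positive. *)
Lemma replaced_sign I (i : 'I_p.+1) : I \in paired r.+1 n.-1 2 ->
  all (fun x => x <= k + p.+1)%N I ->
  0 < (-1) ^+ (i + nth 0%N I i).+1 * tw (B *m Z) (set_row i (zrow Z 1) (zmx Z I)).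
Proof.
move=> hI Ile; have sI : size I = p.+1 by rewrite (size_paired hI) -pr.
have [j [_ _ oI aI]] := (mem_pairedP _ _ _ _).1 hI.
have T0 : 0 < T I by apply: paired_sign hI _ _; lia.
have iI : (i < size I)%N by rewrite sI.
have Id : I = take i I ++ nth 0%N I i :: drop i.+1 I.
  by rewrite -drop_nth // cat_take_drop.
pose s := take i I ++ drop i.+1 I.
have ss : subseq s I.
  rewrite [X in subseq _ X]Id; apply: cat_subseq => //; exact: subseq_cons.
have szs : size (1%N :: s) = p.+1.
  by rewrite /s /= size_cat; move: sI; rewrite {1}Id size_cat /= addnS.
have as2 : all (fun x => 1 < x <= k + p.+1)%N s.
  apply/allP => x /(mem_subseq ss) xI.
  by have := allP aI x xI; have := allP Ile x xI; lia.
have os : sorted ltn (1%N :: s).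
  rewrite /= path_sortedE; last exact: ltn_trans.
  rewrite (subseq_sorted ltn_trans ss oI) andbT.
  by apply: sub_all as2 => x /andP[].
have H1 : 0 < (-1) ^+ (\sum_(a < p.+1) (k + a + nth 0%N (1%N :: s) a)) * T (1%N :: s).
  apply: sorted_sign => //=.
  by apply/andP; split; [lia|apply: sub_all as2 => x /=; lia].
have HI : 0 < (-1) ^+ (\sum_(a < p.+1) (k + a + nth 0%N I a)) * T I.
  apply: sorted_sign => //; apply/allP => x xI.
  by have := allP aI x xI; have := allP Ile x xI; lia.
have parI : ~~ odd (\sum_(a < p.+1) (k + a + nth 0%N I a)).
  apply/negP => oddI; move: HI; rewrite -signr_odd oddI expr1 mulN1r oppr_gt0.
  by rewrite ltNge (ltW T0).
rewrite set_row_zmx // tw_move; last by rewrite -[RHS]sI {3}Id !size_cat.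
rewrite size_takel ?(ltnW iI) // mulrA -exprD -/s.
move: H1; rewrite -signr_odd -[X in _ -> 0 < X * _]signr_odd.
rewrite (_ : odd (\sum_(a < p.+1) (k + a + nth 0%N (1%N :: s) a)) =
  odd ((i + nth 0%N I i).+1 + i)) //.
move: parI; rewrite !odd_index_sum // {1}Id /s /= !sumn_cat /= add0n !oddD.
by do 5!case: odd.
Qed.

(** If [I] stays within the first [k + p.+1] vertices, all replacement signs are explicit, and the
    criterion of [cone_degree] is exactly the parity condition of [alternating_list]. Otherwise one
    replacement that keeps the sign suffices to exclude the origin. *)
Lemma cone_value Q I : oriented_quotient (B *m Z) Q -> I \in paired r.+1 n.-1 2 ->
  homologous (@sphere R p.+1)
    (altdel (@rad_chain R p) (zrow Z 1 *m Q :: row_list (zmx Z I *m Q)))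
    (sphere_class R p.+1 *~ (alternating_list (k + p.+1) I : nat)).
Proof.
move=> oQ hI; have sI : size I = p.+1 by rewrite (size_paired hI) -pr.
have T0 : 0 < T I by apply: paired_sign hI _ _; lia.
have [Ile|] := boolP (all (fun x => x <= k + p.+1)%N I).
  have sg := replaced_sign _ hI Ile.
  have gen i : tw (B *m Z) (set_row i (zrow Z 1) (zmx Z I)) != 0.
    by have := sg i; apply: contraTneq => ->; rewrite mulr0 ltxx.
  have := cone_eval oQ (lt0r_neq0 T0) gen.
  rewrite (_ : cone_degree _ _ _ = (alternating_list (k + p.+1) I : nat)) //.
  rewrite /cone_degree /alternating_list Ile /= sI gtr0_sgz //.
  have neg (i : 'I_p.+1) : (tw (B *m Z) (set_row i (zrow Z 1) (zmx Z I)) * T I < 0) =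
      ~~ odd (i + nth 0%N I i).
    rewrite pmulr_llt0 //; have := sg i; rewrite -signr_odd /=.
    case: odd => /=; rewrite ?expr0 ?expr1 ?mul1r ?mulN1r ?oppr_gt0 //.
    by move=> h; apply/negbTE; rewrite -leNgt ltW.
  rewrite (_ : [forall i, _] = all (fun i => ~~ odd (i + nth 0%N I i)) (iota 0 p.+1)).
    by case: all.
  apply/forallP/allP => [h i|h i]; rewrite ?neg.
    rewrite mem_iota add0n /= => hi.
    by have := h (Ordinal hi); rewrite neg.
  by apply: h; rewrite mem_iota /= add0n.
move=> nI; rewrite [alternating_list _ _]/alternating_list (negbTE nI) [_ && _]/= mulr0z.
have [j [Ij sj oI aI]] := (mem_pairedP _ _ _ _).1 hI.
case/lastP: j Ij sj => [//|j x] Ij sj.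
have {}Ij : I = pairs j ++ [:: x; x.+1] by rewrite Ij /pairs map_rcons flatten_rcons.
have {}sj : size j = r by move: sj; rewrite size_rcons => -[].
have sJ : size (pairs j) = r.*2 by rewrite size_pairs sj.
have xI : x \in I by rewrite Ij mem_cat mem_head orbT.
have x1I : x.+1 \in I by rewrite Ij mem_cat !inE eqxx !orbT.
have Jx y : y \in pairs j -> (y < x)%N.
  move=> yJ; move: oI; rewrite Ij (sorted_pairwise ltn_trans) pairwise_cat.
  by case/andP=> /allP/(_ y yJ) /= /andP[].
have xk : (k + p.+1 <= x)%N.
  rewrite leqNgt; apply: contra nI => xk; apply/allP => y.
  rewrite Ij mem_cat !inE => /orP[/Jx|/orP[]/eqP->]; lia.
have xn : (x.+1 <= n)%N by have := allP aI _ x1I; lia.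
have oJ : sorted ltn (pairs j).
  by apply: (subseq_sorted ltn_trans) oI; rewrite Ij prefix_subseq.
have hJ l : (x <= l)%N -> pairs j \in paired r l.-2 2.
  move=> xl; apply/mem_pairedP; exists j; split => //; apply/allP => y yJ.
  have yI : y \in I by rewrite Ij mem_cat yJ.
  by have := Jx y yJ; have := allP aI y yI; lia.
(* Vertex 1 replaces [x.+1] if [k] is odd and [x] if [k] is even. Moving it to the front gives the
   sign (-1)^k, which cancels the one in [cyclic_sign] for [l = x], respectively [l = x.+1]; so the
   twistor coordinate stays positive. *)
have [ok|ek] := boolP (odd k).
  apply: (cone_eval_null (i := ord_max) oQ (lt0r_neq0 T0)).
  rewrite pmulr_lgt0 // set_row_zmx //.
  have -> : take (ord_max : 'I_p.+1) I ++ 1%N :: drop (ord_max : 'I_p.+1).+1 I =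
      rcons (pairs j) x ++ [:: 1%N].
    rewrite drop_oversize ?sI // Ij -cat_rcons take_size_cat // size_rcons sJ /=; lia.
  rewrite tw_move; last by rewrite size_cat size_rcons sJ /=; lia.
  rewrite cats0 size_rcons sJ exprS -signr_odd odd_double mulN1r expr0 mulN1r.
  have := @cyclic_sign (pairs j) x _ (hJ x (leqnn _)); rewrite xk (ltnW xn) => /(_ isT).
  by rewrite -signr_odd ok mulN1r.
have hp : (r.*2 < p.+1)%N by lia.
apply: (cone_eval_null (i := Ordinal hp) oQ (lt0r_neq0 T0)).
rewrite pmulr_lgt0 // set_row_zmx //.
have -> : take (Ordinal hp) I ++ 1%N :: drop (Ordinal hp).+1 I =
    pairs j ++ 1%N :: [:: x.+1].
  rewrite /= (_ : drop r.*2.+1 I = [:: x.+1]); first by rewrite Ij take_size_cat.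
  by rewrite Ij -cat_rcons drop_size_cat // size_rcons sJ.
rewrite tw_move; last by rewrite size_cat sJ /=; lia.
rewrite sJ -signr_odd odd_double mul1r cats1.
have := @cyclic_sign (pairs j) x.+1 _ (hJ x.+1 (leqnSn _)).
rewrite (leqW xk) xn => /(_ isT).
by rewrite -signr_odd (negbTE ek) mul1r.
Qed.

Lemma winding_final : has_winding_number Z (B *m Z) 'C((k + p)./2, r.+1)%:Z.
Proof.
move=> Q oQ; have n2 : (1 < n)%N by lia.
rewrite [X in homologous _ X](push_winding_cycle_fill Z Q pr n2).
have -> : \sum_(I <- paired r.+1 n.-1 2) altdel (@rad_chain R p) (zpts Z Q (1%N :: I)) =
    \sum_(I <- paired r.+1 n.-1 2)
      altdel (@rad_chain R p) (zrow Z 1 *m Q :: row_list (zmx Z I *m Q)).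
  rewrite !big_seq; apply: eq_bigr => I hI.
  by rewrite -zptsE ?(size_paired hI) -?pr.
have := homologous_big (fun I hI => cone_value oQ (I := I) hI).
rewrite -mulrz_sumr.
have -> : \sum_(I <- paired r.+1 n.-1 2) Posz (alternating_list (k + p.+1) I) =
    Posz (count (alternating_list (k + p.+1)) (paired r.+1 n.-1 2)).
  by elim: (paired _ _ _) => [|I s IH]; rewrite ?big_nil ?big_cons //= IH PoszD.
rewrite count_alternating //; last by lia.
have e : ((k + p.+1).+1 - 2 = k + p)%N by lia.
by rewrite -scaler_int intz e.
Qed.

End FinalCount.

(** * The winding number formula *)

Theorem theorem1 (R : realType) (n k m : nat)
    (hm : (2 <= m)%N) (m_even : ~~ odd m) (hn : (k + m <= n)%N)
    (Z : 'M[R]_(n, k + m)) (hZ : positive_rows Z)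
    (Y : 'M[R]_(k, k + m)) (hY : amplituhedron Z Y)
    (hwcb : off_coarse_boundary Z Y) :
  has_winding_number Z Y ('C((k + m - 1) %/ 2, m %/ 2)%N)%:Z.
Proof.
case: m hm m_even hn Z hZ Y hY hwcb => [//|p] hm m_even hn Z hZ Y [C [rC C0 ->]] [hI hJ].
pose r := (p.+1)./2.-1.
have pr : p.+1 = r.+1.*2 by rewrite /r; lia.
have ph : p.+1./2 = r.+1 by rewrite pr doubleK.
have -> : 'C((k + p.+1 - 1) %/ 2, p.+1 %/ 2) = 'C((k + p)./2, r.+1).
  by rewrite !divn2 ph addnS subn1.
rewrite ph in hI hJ.
have P1 : n.+1 = (1 + n)%N by lia.
have P2 : n.-1.+1 = (2 + n.-2)%N by lia.
have gC : good r Z C.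
  split => // F; rewrite mem_cat => /orP[/mapP[I II ->]|/mapP[J JJ ->]].
    by apply: hI; rewrite (perm_mem (perm_pair_lists r.+1 P1)).
  have sJ := size_paired JJ.
  have := hJ J; rewrite (perm_mem (perm_pair_lists r P2)) => /(_ JJ).
  rewrite -[twistor _ _ _]/(tw (C *m Z) (zmx Z (J ++ [:: n; 1%N]))).
  (* The orders (J, n, 1) and (1, J, n) give twistor coordinates that differ at most by a sign, so
     they vanish together. *)
  rewrite -cat_rcons tw_move; last by rewrite size_cat size_rcons sJ pr doubleS /= addn1.
  by rewrite mulf_eq0 signr_eq0 cats0.
apply: (winding_truncate pr hn hZ rC gC) => B B0 B1 B2.
exact: winding_final.
Qed.
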